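(* There are universal constants $c,C,C_1,C_2>0$ such that the following holds. Let $X\in\mathbb{R}^{n\times k}$ and $\mathbf{e}\in\mathbb{R}^n$ be independent, zero-mean sub-Gaussian with parameters $(\frac1n\Sigma_x,\frac1n)$ and $(\frac1n\sigma^2,\frac1n\sigma_e^2)$ respectively, with $\lambda_{\min}(\Sigma_x)>0$. Let $\beta^*\in\mathbb{R}^k$ and $\mathbf{y}=X\beta^*+\mathbf{e}$. Let $\rho\in[0,1)$ and let $Z\in\mathbb{R}^{n\times k}$ be obtained from $X$ by replacing each entry by $0$ with probability $\rho$ and leaving it unchanged with probability $1-\rho$, independently over entries and independently of $X$ and $\mathbf{e}$. Let $M\in\mathbb{R}^{k\times k}$ have entries $M_{ii}=\frac1{1-\rho}$ and $M_{ij}=\frac1{(1-\rho)^2}$ for $i\ne j$, and set $\hat\Sigma=(Z^\top Z)\odot M$ and $\hat\gamma=\frac1{1-\rho}Z^\top\mathbf{y}$. Let $p\ge k$ and suppose $$n\ge c\,\frac{1}{(1-\rho)^4\lambda_{\min}^2(\Sigma_x)}\,k\log p .$$ Then, with probability at least $1-C_1p^{-C_2}$, $\hat\Sigma$ is positive definite and $\hat\beta=\hat\Sigma^{-1}\hat\gamma$ satisfies $$\|\hat\beta-\beta^*\|_2\le C\left(\frac1{(1-\rho)^2}\|\beta^*\|_2+\frac1{1-\rho}\sigma_e\right)\frac1{\lambda_{\min}(\Sigma_x)}\sqrt{\frac{k\log p}{n}} .$$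
   Context: Definitions. A zero-mean real random variable $v$ is sub-Gaussian with parameter $\sigma_v$ if $\mathbb{E}[\exp(\lambda v)]\le\exp(\sigma_v^2\lambda^2/2)$ for all $\lambda\in\mathbb{R}$. A zero-mean random matrix $V$ with $n$ rows and $q$ columns is sub-Gaussian with parameter $(\frac1n\Sigma,\frac1n\sigma^2)$ if (1) its rows $\mathbf{v}_1^\top,\dots,\mathbf{v}_n^\top$ are independent with $\mathbb{E}[\mathbf{v}_i\mathbf{v}_i^\top]=\frac1n\Sigma$ for every $i$, and (2) for every unit vector $\mathbf{u}\in\mathbb{R}^q$, $\mathbf{u}^\top\mathbf{v}_i$ is sub-Gaussian with parameter at most $\frac{1}{\sqrt n}\sigma$. The vector $\mathbf{e}$ is viewed as an $n\times 1$ matrix. The columns of $X$ may be dependent. $\odot$ denotes the entrywise product. Universal constants do not depend on $n,p,k,\rho$ or any of the variance parameters. $p$ is only a parameter indexing the guarantee. *)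

(* Defs.v *)
From HB Require Import structures.
From mathcomp Require Export all_boot all_order all_algebra.
From mathcomp Require Export all_classical all_reals all_analysis.

Set Implicit Arguments.
Unset Strict Implicit.
Unset Printing Implicit Defensive.

Import Order.TTheory GRing.Theory Num.Theory.

Local Open Scope classical_set_scope.
Local Open Scope ring_scope.

Section Matrices.
Context {R : realType}.

Definition l2norm q (u : 'cV[R]_q) : R := Num.sqrt (\sum_i u i 0 ^+ 2).

(* A real symmetric matrix with [q > 0] has a finite nonempty set of
   eigenvalues, so that this infimum is then its smallest eigenvalue; the
   value is junk ([0]) when there is no real eigenvalue. *)
Definition lambda_min q (A : 'M[R]_q) : R := inf [set a | eigenvalue A a].

Definition pos_def q (A : 'M[R]_q) : Prop :=
  A^T = A /\ forall u : 'cV[R]_q, u != 0 -> 0 < (u^T *m A *m u) 0 0.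

Definition hadamard m q (A B : 'M[R]_(m, q)) : 'M[R]_(m, q) :=
  map2_mx *%R A B.

(* [D i j = true] means that the entry [(i, j)] is erased. *)
Definition erase m q (D : 'M[bool]_(m, q)) (A : 'M[R]_(m, q)) : 'M[R]_(m, q) :=
  \matrix_(i, j) (if D i j then 0 else A i j).

Definition correction_mx k (rho : R) : 'M[R]_k :=
  \matrix_(i, j) (if i == j then (1 - rho)^-1 else ((1 - rho) ^+ 2)^-1).

Definition Sigma_hat n k (rho : R) (Z : 'M[R]_(n, k)) : 'M[R]_k :=
  hadamard (Z^T *m Z) (correction_mx k rho).

Definition gamma_hat n k (rho : R) (Z : 'M[R]_(n, k)) (y : 'cV[R]_n) :
  'cV[R]_k := (1 - rho)^-1 *: (Z^T *m y).

Definition beta_hat n k (rho : R) (Z : 'M[R]_(n, k)) (y : 'cV[R]_n) :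
  'cV[R]_k := invmx (Sigma_hat rho Z) *m gamma_hat rho Z y.

End Matrices.

Section RandomMatrices.
Context {d : measure_display} {T : measurableType d} {R : realType}.
Variable P : probability T R.

Definition random_mx {d'} {S : measurableType d'} m q (V : T -> 'M[S]_(m, q)) :
  Prop := forall i j, measurable_fun setT (fun w => V w i j).

Definition sigma_mx {d'} {S : measurableType d'} m q (V : T -> 'M[S]_(m, q)) :
  set (set T) :=
  <<s \bigcup_(ij : 'I_m * 'I_q)
        preimage_set_system setT (fun w => V w ij.1 ij.2) measurable >>.

Definition independent (F G : set (set T)) : Prop :=
  forall A B, F A -> G B -> P (A `&` B) = (P A * P B)%E.

Definition mutually_independent (I : finType) (F : I -> set (set T)) : Prop :=
  forall (J : {set I}) (A : I -> set T), (forall i, i \in J -> F i (A i)) ->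
    P (\bigcap_(i in [set` J]) A i) = (\prod_(i in J) P (A i))%E.

Definition subgaussian (v : T -> R) (s : R) : Prop :=
  [/\ measurable_fun setT v,
      ('E_P[v] = 0)%E &
      forall l : R,
        ('E_P[fun w => expR (l * v w)%R] <=
         (expR (s ^+ 2 * l ^+ 2 / 2)%R)%:E)%E].

(* "Sub-Gaussian with parameter (Sigma / n, sigma ^ 2 / n)", where n is the
   number of rows; [row i (V w)] is v_i^T and the normalisation by n is part of
   the definition. *)
Definition subgaussian_mx n q (V : T -> 'M[R]_(n, q)) (Sigma : 'M[R]_q)
    (sigma : R) : Prop :=
  [/\ random_mx V,
      forall i j, ('E_P[fun w => V w i j] = 0)%E,
      mutually_independent (fun i => sigma_mx (fun w => row i (V w))),
      forall i j l,
        ('E_P[fun w => (V w i j * V w i l)%R] = (n%:R^-1 * Sigma j l)%R%:E)%E &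
      forall (i : 'I_n) (u : 'cV[R]_q), l2norm u = 1 ->
        exists s : R, [/\ 0 <= s, s <= (Num.sqrt n%:R)^-1 * sigma &
          subgaussian (fun w => (row i (V w) *m u) 0 0) s]].

Definition erasure_mask n q (rho : R) (D : T -> 'M[bool]_(n, q)) : Prop :=
  [/\ random_mx D,
      forall i j, P [set w | D w i j] = rho%:E &
      mutually_independent (fun ij : 'I_n * 'I_q =>
        preimage_set_system setT (fun w => D w ij.1 ij.2) measurable)].

End RandomMatrices.

(* Main.v *)
From HB Require Import structures.
Require Import Defs.
From mathcomp Require Import all_boot all_order all_algebra.
From mathcomp Require Import all_classical all_reals all_analysis.
From mathcomp Require Import measurable_realfun zify ring lra.
Import Order.TTheory GRing.Theory Num.Theory.
Local Open Scope classical_set_scope.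
Local Open Scope ring_scope.
Set Implicit Arguments.
Unset Strict Implicit.
Unset Printing Implicit Defensive.
Import HBNNSimple.

(** Let [r := gamma_hat - Sigma_hat *m beta], so that
    [beta_hat - beta = invmx Sigma_hat *m r] as soon as [Sigma_hat] is
    invertible.  Two facts give the estimate ([l2norm_solve_le]): the quadratic
    form of [Sigma_hat] is at least half of the smallest eigenvalue [lam] of
    [Sigma_x] on the unit sphere, and every coordinate of [r] is at most a
    multiple of [(|beta| / (1 - rho)^2 + sigma_e / (1 - rho)) sqrt (ln p / n)].

    Concentration.  For a fixed direction [u] the number [u^T Sigma_hat u], and
    for a fixed index [j] the number [r_j], is a sum of [n] independent terms,
    one for each row.  Since the correction matrix is
    [(1 - rho)^-2 (J - rho I)], with [J] the all-ones matrix, each term is a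
    short combination of products of two sub-Gaussian variables of size
    [1 / sqrt n] ([row_qformE], [row_residualE]).  A masked row is still
    sub-Gaussian: once the mask is fixed, its product with [u] is the product
    of the row of [X] with a vector that is no longer than [u] ([psi2_Z]).  A
    product of two sub-Gaussian variables is sub-exponential ([psi1_mul]), so
    its centred moment generating function is at most quadratic in the exponent
    near [0] ([psi1_mgf]), and the Chernoff bound yields a tail
    [2 exp (- n t^2 / 128)] for levels [t <= 32] ([bernstein]).  The means are
    the right ones because the correction undoes exactly the factors [1 - rho]
    and [(1 - rho)^2] that masking puts in front of the second moments
    ([has_mean_ZZ], [has_mean_ZX]), and because [X] and [e] are centred and
    independent ([has_mean_Ze]).

    Uniformity in [u].  The exponent available for one direction is a multiple
    of [k ln p], so a union bound over [p ^ (6 k)] directions is affordable.  As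
    [k <= p], this leaves room for all the points of mesh [1 / (4 k^2)] of the
    cube; a bound on those points controls the entries of the matrix by
    polarization, hence its quadratic form on the whole sphere
    ([qform_le_grid]).  The comparison with [lam] uses that the least Rayleigh
    quotient of a symmetric matrix is an eigenvalue ([lambda_min_qform]).

    Independence.  The joint sigma-algebra of a row of the mask, of [X] and of
    [e] is generated by rectangles, on which the product rule is a direct
    consequence of the hypotheses ([rows_independent]).  [expectation_prod]
    lifts the product rule from such generators to expectations of products,
    replacing one indicator at a time by a function.

    Measurability.  A lower bound on the probability of the final event is
    obtained by monotonicity, which requires this event to be measurable.
    Positive definiteness amounts to a nonzero determinant and countably many
    inequalities ([pos_def_grid]), and the inverse can be traded for the
    adjugate ([measurable_solve_close]). *)

(** * Expectations of products of independent functions *)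

Section OneStep.
Context d (T : measurableType d) (R : realType) (P : probability T R).

Lemma measurable_fun_sub_sigma (G : set (set T)) d' (S : measurableType d')
    (f : T -> S) :
  G `<=` d.-measurable ->
  measurable_fun [set: g_sigma_algebraType G] f -> measurable_fun [set: T] f.
Proof.
move=> Gm mf _ Y mY.
have : <<s G >> ([set: T] `&` f @^-1` Y) by apply: mf.
apply: (smallest_sub (sigma_algebra_measurable T)); exact: Gm.
Qed.

Local Open Scope ereal_scope.

Lemma expectationE (f : T -> R) : 'E_P[f] = \int[P]_w (f w)%:E.
Proof. by rewrite unlock. Qed.

(** Both sides are finite measures in [A] that agree on a pi-system, hence on
    the sigma-algebra that it generates. *)
Lemma expectation_indic_sigma (G : set (set T)) (H : T -> R) (c : R) :
  G `<=` d.-measurable -> setI_closed G -> G setT ->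
  measurable_fun setT H -> (forall w, 0 <= H w)%R -> (0 <= c)%R ->
  (forall A, G A -> \int[P]_(w in A) (H w)%:E = c%:E * P A) ->
  forall A, <<s G >> A -> \int[P]_(w in A) (H w)%:E = c%:E * P A.
Proof.
move=> Gm GI GT mH H0 c0 HG.
pose nu := fun A => \int[P]_(w in A) (H w)%:E.
have nu0 : nu set0 = 0 by exact: integral_set0.
have nuge0 A : 0 <= nu A by apply: integral_ge0 => w _; rewrite lee_fin.
have nuadd : semi_sigma_additive nu.
  apply: semi_sigma_additive_nng_induced; first exact/measurable_EFinP.
  by move=> x; rewrite lee_fin.
pose m1 := isMeasure.Build _ _ _ nu nu0 nuge0 nuadd.
pose M1 : {measure set T -> \bar R} := HB.pack nu m1.
pose M2 : {measure set T -> \bar R} := mscale (NngNum c0) P.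
move=> A GA.
apply: (@g_sigma_algebra_measure_unique _ _ _ G Gm (fun=> setT) _ _ M1 M2) => //.
  by rewrite bigcup_const.
move=> _; rewrite /M1 /= /nu (HG _ GT) probability_setT mule1; exact: ltry.
Qed.

(** A function [H] that has the same weighted indicators as the constant [c] on
    a pi-system cannot be told apart from [c] by functions measurable with
    respect to the generated sigma-algebra: the identity extends from
    indicators to simple functions by linearity and then to [g] by monotone
    convergence. *)
Lemma expectationM_sigma (G : set (set T)) (H g : T -> R) (c : R) :
  G `<=` d.-measurable -> setI_closed G -> G setT ->
  measurable_fun setT H -> (forall w, 0 <= H w)%R -> (0 <= c)%R ->
  (forall A, G A -> \int[P]_(w in A) (H w)%:E = c%:E * P A) ->
  measurable_fun [set: g_sigma_algebraType G] g -> (forall w, 0 <= g w)%R ->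
  'E_P[fun w => H w * g w]%R = c%:E * 'E_P[g].
Proof.
move=> Gm GI GT mH H0 c0 HG mg g0.
have HsG := expectation_indic_sigma Gm GI GT mH H0 c0 HG.
have mE : measurable_fun [set: g_sigma_algebraType G] (EFin \o g).
  exact/measurable_EFinP.
pose h := nnsfun_approx (@measurableT _ (g_sigma_algebraType G)) mE.
have hcvg w : (EFin \o (h ^~ w)) x @[x --> \oo] --> (g w)%:E.
  by apply: (cvg_nnsfun_approx measurableT mE) => // x _ /=; rewrite lee_fin.
have hmono w : {homo (h ^~ w) : n m / (n <= m)%N >-> (n <= m)%R}.
  by move=> n m nm; exact/lefP/nd_nnsfun_approx.
have mh n : measurable_fun [set: T] (h n).
  by apply: (measurable_fun_sub_sigma Gm); exact/measurable_funP.
have meh n : measurable_fun [set: T] (fun w : T => (h n w)%:E).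
  by have /measurable_EFinP := mh n.
have mpre n r : measurable ((h n @^-1` [set r]) : set T).
  by rewrite -[X in measurable X]setTI; apply: mh.
rewrite !expectationE.
have -> : \int[P]_w (g w)%:E = limn (fun n => \int[P]_w (h n w)%:E).
  rewrite -monotone_convergence//.
  - by apply: eq_integral => w _; apply/esym/cvg_lim => //; exact: hcvg.
  - by move=> n w _; rewrite lee_fin.
  - by move=> w _ m n mn; rewrite lee_fin; exact: hmono.
have -> : \int[P]_w (H w * g w)%:E = limn (fun n => \int[P]_w (H w * h n w)%:E).
  rewrite -monotone_convergence//.
  - apply: eq_integral => w _; apply/esym/cvg_lim => //.
    under eq_fun do rewrite EFinM; rewrite EFinM.
    by apply: cvgeZl => //; exact: hcvg.
  - by move=> n; apply/measurable_EFinP/measurable_funM => //; exact: mh.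
  - by move=> n w _; rewrite lee_fin mulr_ge0.
  - by move=> w _ m n mn; rewrite lee_fin ler_wpM2l//; exact: hmono.
have step n : \int[P]_w (H w * h n w)%:E = c%:E * \int[P]_w (h n w)%:E.
  have ge0y y w : (0 <= y * \1_(h n @^-1` [set y]) w)%R.
    by have := nnfun_muleindic_ge0 (h n) y w; rewrite lee_fin.
  have mi y : measurable_fun setT (fun w : T => (y * \1_(h n @^-1` [set y]) w)%R).
    apply: measurable_funM => //; exact/measurable_indic/mpre.
  have simple (K : T -> R) : measurable_fun setT K -> (forall w, 0 <= K w)%R ->
      \int[P]_w (K w * h n w)%:E = \sum_(y \in range (h n))
        y%:E * \int[P]_(w in h n @^-1` [set y]) (K w)%:E.
    move=> mK K0.
    transitivity (\int[P]_w (\sum_(y \in range (h n))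
        (y * \1_(h n @^-1` [set y]) w * K w)%:E)).
      apply: eq_integral => w _.
      by rewrite fsumEFin// -mulr_fsuml -fimfunE mulrC.
    rewrite ge0_integral_fsum//; last 2 first.
      - by move=> y; apply/measurable_EFinP; exact: measurable_funM.
      - by move=> y w _; rewrite lee_fin mulr_ge0.
    apply: eq_fsbigr => y; rewrite inE => -[x _ yE].
    under eq_integral do rewrite -mulrA EFinM.
    rewrite ge0_integralZl//; last 3 first.
      - by apply/measurable_EFinP; exact: measurable_funM.
      - by move=> w _; rewrite lee_fin mulr_ge0.
      - by rewrite -yE lee_fin.
    congr (_ * _); rewrite [RHS]integral_mkcond; apply: eq_integral => w _.
    by rewrite epatch_indic muleC -EFinM.
  rewrite simple//.
  transitivity (\sum_(y \in range (h n)) c%:E * (y%:E * P (h n @^-1` [set y]))).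
    apply: eq_fsbigr => y _.
    have sA : <<s G >> ([set: T] `&` h n @^-1` [set y]).
      exact: (@measurable_funP _ _ _ _ _ (h n)).
    by move: sA; rewrite setTI => /HsG ->; rewrite muleCA.
  have := simple (cst 1%R); under eq_integral do rewrite mul1r.
  move=> /(_ (measurable_cst _) (fun=> ler01)) ->.
  have -> : \sum_(y \in range (h n))
      y%:E * \int[P]_(w in h n @^-1` [set y]) (cst 1%R w)%:E =
      \sum_(y \in range (h n)) y%:E * P (h n @^-1` [set y]).
    apply: eq_fsbigr => y _; congr (_ * _).
    by rewrite -[RHS]mul1e -(integral_cst P (mpre n y)).
  rewrite ge0_mule_fsumr// => y.
  have [[x _ <-]|yn] := pselect (range (h n) y).
    by apply: mule_ge0 => //; rewrite lee_fin.
  rewrite (_ : h n @^-1` [set y] = set0) ?measure0 ?mule0//.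
  by rewrite -subset0 => x /= xy; apply: yn; exists x.
under eq_fun do rewrite step.
apply/cvg_lim => //; apply: cvgeZl => //.
apply: ereal_nondecreasing_is_cvgn => m n mn.
by apply: ge0_le_integral => // w _; rewrite lee_fin ?hmono.
Qed.

(** Every [G i] contains [setT], so the product rule over the whole index set
    includes the one over each subfamily. *)
Definition independent_pi_systems (I : finType) (G : I -> set (set T)) : Prop :=
  [/\ forall i, G i `<=` d.-measurable,
      forall i, setI_closed (G i),
      forall i, G i setT &
      forall A, (forall i, G i (A i)) -> P (\bigcap_i A i) = \prod_i P (A i)].

(** The product rule is a statement on indicators of members of the [G i].
    They are replaced by the functions [g i] one after the other; a replacement
    is an instance of [expectationM_sigma], where [H] is the product of all the
    other factors. *)
Lemma expectation_prod (I : finType) (G : I -> set (set T)) (g : I -> T -> R)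
    (e : I -> R) :
  independent_pi_systems G ->
  (forall i, measurable_fun [set: g_sigma_algebraType (G i)] (g i)) ->
  (forall i w, 0 <= g i w)%R -> (forall i, 'E_P[g i] = (e i)%:E) ->
  'E_P[fun w => \prod_i g i w]%R = (\prod_i e i)%:E.
Proof.
move=> [Gm GI GT Gind] mg g0 ge.
have e0 i : (0 <= e i)%R by rewrite -lee_fin -ge expectation_ge0.
pose f (s : seq I) A i w : R := if i \in s then g i w else \1_(A i) w.
pose q (s : seq I) A i : R := if i \in s then e i else fine (P (A i)).
have mA i A : G i A -> measurable A by exact: Gm.
have f0 s A i w : (0 <= f s A i w)%R by rewrite /f; case: ifP.
have mf s A i : G i (A i) -> measurable_fun setT (f s A i).
  move=> GA; rewrite /f; case: (i \in s); last by apply: measurable_indic; exact: mA GA.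
  exact: (measurable_fun_sub_sigma (Gm i)).
suff /(_ (enum I) (fun=> setT) GT) : forall s A, (forall i, G i (A i)) ->
    'E_P[fun w => \prod_i f s A i w]%R = (\prod_i q s A i)%:E.
  under eq_fun do under eq_bigr do rewrite /f mem_enum inE.
  by under eq_bigr do rewrite /q mem_enum inE.
elim=> [A GA|i s IH A GA].
  transitivity (P (\bigcap_i A i)); last first.
    rewrite Gind// -prodEFin; apply: eq_bigr => i _.
    by rewrite /q in_nil fineK// fin_num_measure//; exact: mA (GA i).
  have mcap : measurable (\bigcap_i A i).
    by apply: fin_bigcap_measurable => // i _; exact: mA (GA i).
  rewrite -expectation_indic//; congr ('E_P[_]); apply/funext => w.
  rewrite /f indicE; have [wA|wA] := boolP (w \in \bigcap_i A i).
    rewrite big1// => i _; rewrite indicE mem_set//.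
    by move: wA; rewrite inE; exact.
  have /existsNP[i] : ~ (\bigcap_i A i) w by move: wA; rewrite notin_setE.
  move=> /not_implyP[_ wAi]; apply/eqP; rewrite prodf_seq_eq0; apply/hasP.
  by exists i; rewrite ?mem_index_enum//= indicE memNset.
have [si|sNi] := boolP (i \in s).
  have -> : f (i :: s) A = f s A.
    by apply/funext => l; rewrite /f inE; case: eqP => // ->; rewrite si.
  have -> : q (i :: s) A = q s A.
    by apply/funext => l; rewrite /q inE; case: eqP => // ->; rewrite si.
  exact: IH.
under eq_fun do rewrite (bigD1 i)//= {1}/f mem_head mulrC.
rewrite (bigD1 i)//= {1}/q mem_head mulrC.
rewrite EFinM -ge; apply: (expectationM_sigma (Gm i)) => //.
- by under eq_fun do rewrite -big_filter; apply: measurable_prod => l _; exact: mf.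
- by move=> w; rewrite prodr_ge0.
- by rewrite prodr_ge0// => l _; rewrite /q; case: ifP => // _; exact: fine_ge0.
(* the induction hypothesis with [B] in place of [A i] *)
move=> B GB; pose A' l := if l == i then B else A l.
have GA' l : G l (A' l) by rewrite /A'; case: eqP => // ->.
have fi w : f s A' i w = \1_B w by rewrite /f /A' (negbTE sNi) eqxx.
have qi : q s A' i = fine (P B) by rewrite /q /A' (negbTE sNi) eqxx.
have := IH A' GA'.
under eq_fun do rewrite (bigD1 i)//= fi.
rewrite (bigD1 i)//= qi.
have fE l w : l != i -> f (i :: s) A l w = f s A' l w.
  by move=> li; rewrite /f /A' inE (negbTE li).
have qE l : l != i -> q (i :: s) A l = q s A' l.
  by move=> li; rewrite /q /A' inE (negbTE li).
under eq_bigr do rewrite -qE//.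
rewrite EFinM fineK ?fin_num_measure//; last exact: mA GB.
rewrite muleC => <-; rewrite expectationE integral_mkcond.
apply: eq_integral => w _; rewrite epatch_indic/= muleC -EFinM.
by congr (_ * _)%:E; apply: eq_bigr => l; exact: fE.
Qed.
End OneStep.

(** * Expectations and means of real functions *)

Section Expectation.
Context d (T : measurableType d) (R : realType) (P : probability T R).
Local Open Scope ereal_scope.

Lemma ge0_le_expectation (X Y : T -> R) :
  measurable_fun setT X -> measurable_fun setT Y ->
  (forall w, 0 <= X w <= Y w)%R -> 'E_P[X] <= 'E_P[Y].
Proof.
move=> mX mY XY; apply: expectation_le => //.
- by move=> w; case/andP: (XY w).
- by move=> w; case/andP: (XY w) => X0 /(le_trans X0).
- by apply: aeW => w; case/andP: (XY w).
Qed.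

Lemma ge0_expectationZl (X : T -> R) (k : R) :
  measurable_fun setT X -> (forall w, 0 <= X w)%R -> (0 <= k)%R ->
  'E_P[fun w => k * X w]%R = k%:E * 'E_P[X].
Proof.
move=> mX X0 k0; rewrite !expectationE.
under eq_integral do rewrite EFinM.
rewrite ge0_integralZl//; first exact/measurable_EFinP.
by move=> w _; rewrite lee_fin.
Qed.

Lemma ge0_expectationD (X Y : T -> R) :
  measurable_fun setT X -> measurable_fun setT Y ->
  (forall w, 0 <= X w)%R -> (forall w, 0 <= Y w)%R ->
  'E_P[fun w => X w + Y w]%R = 'E_P[X] + 'E_P[Y].
Proof.
move=> mX mY X0 Y0; rewrite !expectationE.
under eq_integral do rewrite EFinD.
have mE (Z : T -> R) : measurable_fun setT Z -> measurable_fun setT (fun w => (Z w)%:E).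
  by move=> mZ; apply/measurable_EFinP.
by apply: ge0_integralD => //; [move=> w _; rewrite lee_fin|exact: mE|
  move=> w _; rewrite lee_fin|exact: mE].
Qed.

Lemma ge0_expectation_sum (I : Type) (s : seq I) (X : I -> T -> R) :
  (forall i, measurable_fun setT (X i)) -> (forall i w, 0 <= X i w)%R ->
  'E_P[fun w => \sum_(i <- s) X i w]%R = \sum_(i <- s) 'E_P[X i].
Proof.
move=> mX X0; rewrite expectationE.
under eq_integral do rewrite -sumEFin.
rewrite ge0_integral_sum//; last 2 first.
- by move=> i; exact/measurable_EFinP.
- by move=> i w _; rewrite lee_fin.
by apply: eq_bigr => i _; rewrite expectationE.
Qed.

(** Integrability is part of the statement, which makes means additive. *)
Definition has_mean (X : T -> R) (m : R) :=
  P.-integrable setT (EFin \o X) /\ 'E_P[X] = m%:E.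

Lemma has_mean_integrable (X : T -> R) :
  P.-integrable setT (EFin \o X) -> has_mean X (fine 'E_P[X]).
Proof.
move=> iX; split=> //.
by rewrite fineK//; apply/expectation_fin_num/Lfun1_integrable.
Qed.

Lemma has_meanD X Y m p :
  has_mean X m -> has_mean Y p -> has_mean (fun w => X w + Y w)%R (m + p).
Proof.
move=> [iX EX] [iY EY]; split.
  apply: (eq_integrable _ (fun w => (X w)%:E + (Y w)%:E)) => //.
  exact: integrableD.
by rewrite EFinD -EX -EY -expectationD//; apply/Lfun1_integrable.
Qed.

Lemma has_meanZ X m (k : R) :
  has_mean X m -> has_mean (fun w => k * X w)%R (k * m).
Proof.
move=> [iX EX]; split.
  apply: (eq_integrable _ (fun w => k%:E * (X w)%:E)) => //.
  exact: integrableZl.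
rewrite EFinM -EX -expectationZl; last exact/Lfun1_integrable.
by congr ('E_P[_]); apply/funext => w; rewrite mulrC.
Qed.

Lemma has_mean0 : has_mean (fun=> 0%R) 0.
Proof.
split; last by rewrite (expectation_cst P 0).
by apply: (eq_integrable _ (cst 0)) => //; exact: integrable0.
Qed.

Lemma has_mean_sum (I : Type) (s : seq I) (X : I -> T -> R) (m : I -> R) :
  (forall i, has_mean (X i) (m i)) ->
  has_mean (fun w => \sum_(i <- s) X i w)%R (\sum_(i <- s) m i).
Proof.
move=> XM; elim: s => [|i s IH].
  under [X in has_mean X]eq_fun do rewrite big_nil; rewrite big_nil.
  exact: has_mean0.
under [X in has_mean X]eq_fun do rewrite big_cons; rewrite big_cons.
exact: has_meanD.
Qed.

Lemma has_mean_measurable X m : has_mean X m -> measurable_fun setT X.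
Proof. by move=> [/integrableP[/measurable_EFinP]]. Qed.

Lemma has_mean_bounded (X Y : T -> R) :
  measurable_fun setT X -> measurable_fun setT Y ->
  (forall w, `|X w| <= Y w)%R -> 'E_P[Y] < +oo ->
  exists m, has_mean X m.
Proof.
move=> mX mY XY EY; exists (fine 'E_P[X]); apply: has_mean_integrable.
apply: (le_integrable measurableT (g := EFin \o Y)).
- exact/measurable_EFinP.
- by move=> w _ /=; rewrite lee_fin (le_trans (XY w))// ler_norm.
apply/integrableP; split; first exact/measurable_EFinP.
rewrite (_ : \int[P]_x _ = 'E_P[Y])// expectationE; apply: eq_integral => w _ /=.
by rewrite ger0_norm// (le_trans _ (XY w)).
Qed.

End Expectation.

(** * Product of two independent variables *)

Section IndependentProducts.
Context d (T : measurableType d) (R : realType) (P : probability T R).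

Lemma has_mean_unique (f : T -> R) a b : has_mean P f a -> has_mean P f b -> a = b.
Proof. by move=> [_ fa] [_]; rewrite fa => -[]. Qed.

Lemma ge0_has_mean (f : T -> R) a : measurable_fun setT f -> (forall w, 0 <= f w) ->
  'E_P[f]%E = a%:E -> has_mean P f a.
Proof.
move=> mf f0 fa.
have [b fb] : exists b, has_mean P f b.
  apply: (has_mean_bounded mf mf) => [w|]; first by rewrite ger0_norm.
  by rewrite fa ltry.
by have [fi fE] := fb; split.
Qed.


Lemma sigma_sub_measurable (F : set (set T)) :
  F `<=` measurable -> <<s F>> `<=` d.-measurable.
Proof. exact: (smallest_sub (sigma_algebra_measurable T)). Qed.

Section pair.
Variables (F G : set (set T)).
Hypothesis Fm : F `<=` d.-measurable.
Hypothesis Gm : G `<=` d.-measurable.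
Hypothesis FG : independent P <<s F >> <<s G >>.

Let sT (H : set (set T)) : <<s H >> setT.
Proof. exact: (@measurableT _ (g_sigma_algebraType H)). Qed.

Let sI (H : set (set T)) : setI_closed <<s H >>.
Proof. by move=> A B; exact: (@measurableI _ (g_sigma_algebraType H)). Qed.

Let mss (H : set (set T)) (f : T -> R) :
  measurable_fun [set: g_sigma_algebraType H] f ->
  measurable_fun [set: g_sigma_algebraType <<s H >>] f.
Proof.
move=> mf _ Y mY; apply: sub_sigma_algebra.
by have := mf measurableT Y mY.
Qed.

(** [expectationM_sigma] is used twice: first to integrate [f] against the
    indicator of a set of the second sigma-algebra, then to integrate [g]
    against [f]. *)
Lemma ge0_expectationM_independent (f g : T -> R) a :
  measurable_fun [set: g_sigma_algebraType F] f ->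
  measurable_fun [set: g_sigma_algebraType G] g ->
  (forall w, 0 <= f w) -> (forall w, 0 <= g w) -> 'E_P[f]%E = a%:E ->
  ('E_P[fun w => (f w * g w)%R] = a%:E * 'E_P[g])%E.
Proof.
move=> mf mg f0 g0 fa.
have a0 : 0 <= a by rewrite -lee_fin -fa expectation_ge0.
have smF := sigma_sub_measurable Fm; have smG := sigma_sub_measurable Gm.
have mfT := measurable_fun_sub_sigma Fm mf.
apply: (@expectationM_sigma _ _ _ P <<s G >> f g a smG (@sI G) (@sT G)) => //; last exact: mss.
move=> A GA; have mA : measurable A by exact: smG.
have PA0 : 0 <= fine (P A) by rewrite fine_ge0.
have PAfin : P A \is a fin_num by exact: fin_num_measure.
have ind B : <<s F >> B -> (\int[P]_(w in B) (\1_A w)%:E = (fine (P A))%:E * P B)%E.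
  move=> FB; rewrite fineK//.
  transitivity (P (A `&` B)); last by rewrite setIC FG// muleC.
  by rewrite integral_indic//; exact: smF.
have mA1 : measurable_fun [set: T] (\1_A : T -> R) by exact: measurable_indic.
have mf' := mss mf.
have ind0 w : 0 <= \1_A w :> R by rewrite indicE ler0n.
have := @expectationM_sigma _ _ _ P <<s F >> \1_A f (fine (P A)) smF (@sI F) (@sT F)
  mA1 ind0 PA0 ind mf' f0.
rewrite fa muleC fineK// => <-.
rewrite expectationE integral_mkcond; apply: eq_integral => w _.
by rewrite epatch_indic/= muleC -EFinM.
Qed.

(** The nonnegative case is applied to the four products of positive and
    negative parts. *)
Lemma has_meanM_independent (f g : T -> R) a b :
  measurable_fun [set: g_sigma_algebraType F] f ->
  measurable_fun [set: g_sigma_algebraType G] g ->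
  has_mean P f a -> has_mean P g b ->
  has_mean P (fun w => f w * g w) (a * b).
Proof.
move=> mf mg fa gb.
pose pos (h : T -> R) w := Num.max (h w) 0.
pose neg (h : T -> R) w := Num.max (- h w) 0.
have pos0 h w : 0 <= pos h w by rewrite le_max lexx orbT.
have neg0 h w : 0 <= neg h w by rewrite le_max lexx orbT.
have decomp h w : h w = pos h w + -1 * neg h w.
  rewrite /pos /neg; have [h0|h0] := leP 0 (h w).
    have h1 : - h w <= 0 by lra.
    rewrite (max_r h1); lra.
  have h1 : 0 <= - h w by lra.
  rewrite (max_l h1); lra.
have mpos d' (S : measurableType d') (h : S -> R) : measurable_fun setT h ->
    measurable_fun setT (fun w => Num.max (h w) 0).
  by move=> mh; apply: measurable_maxr.
have mneg d' (S : measurableType d') (h : S -> R) : measurable_fun setT h ->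
    measurable_fun setT (fun w => Num.max (- h w) 0).
  by move=> mh; apply: measurable_maxr => //; exact: measurable_funN.
have mean (h : T -> R) c : has_mean P h c -> exists p q,
    [/\ has_mean P (pos h) p, has_mean P (neg h) q & c = p + -1 * q].
  move=> hc; have mh := has_mean_measurable hc.
  have [e he] : exists e, has_mean P (fun w => `|h w|) e.
    have [hi _] := hc; exists (fine 'E_P[fun w => (`|h w|)%R]%E).
    by apply: has_mean_integrable; exact: integrable_norm.
  have mn := has_mean_measurable he.
  have elt : ('E_P[fun w => `|h w|%R] < +oo)%E by rewrite he.2 ltry.
  have [p hp] : exists p, has_mean P (pos h) p.
    apply: (has_mean_bounded (mpos _ _ _ mh) mn _ elt) => w.
    by rewrite (ger0_norm (pos0 h w)) ge_max normr_ge0 ler_norm.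
  have [q hq] : exists q, has_mean P (neg h) q.
    apply: (has_mean_bounded (mneg _ _ _ mh) mn _ elt) => w.
    by rewrite (ger0_norm (neg0 h w)) ge_max normr_ge0 -normrN ler_norm.
  exists p, q; split=> //; apply: has_mean_unique hc _.
  have := has_meanD hp (has_meanZ (-1) hq).
  by under [X in has_mean _ X]eq_fun do rewrite -decomp.
have [p [q [fp fq ->]]] := mean _ _ fa; have [r [s [gr gs ->]]] := mean _ _ gb.
have prod (x y : T -> R) c e : has_mean P x c -> has_mean P y e ->
    (forall w, 0 <= x w) -> (forall w, 0 <= y w) ->
    measurable_fun [set: g_sigma_algebraType F] x ->
    measurable_fun [set: g_sigma_algebraType G] y ->
    has_mean P (fun w => x w * y w) (c * e).
  move=> xc ye x0 y0 mx my; apply: ge0_has_mean.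
  - by apply: measurable_funM; [exact: has_mean_measurable xc|exact: has_mean_measurable ye].
  - by move=> w; rewrite mulr_ge0.
  by rewrite (ge0_expectationM_independent mx my x0 y0 xc.2) ye.2 EFinM.
have pr := prod _ _ _ _ fp gr (pos0 f) (pos0 g) (mpos _ _ _ mf) (mpos _ _ _ mg).
have ps := prod _ _ _ _ fp gs (pos0 f) (neg0 g) (mpos _ _ _ mf) (mneg _ _ _ mg).
have qr := prod _ _ _ _ fq gr (neg0 f) (pos0 g) (mneg _ _ _ mf) (mpos _ _ _ mg).
have qs := prod _ _ _ _ fq gs (neg0 f) (neg0 g) (mneg _ _ _ mf) (mneg _ _ _ mg).
have := has_meanD (has_meanD pr (has_meanZ (-1) ps)) (has_meanD (has_meanZ (-1) qr) qs).
congr (has_mean P _ _); last by ring.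
by apply/funext => w; rewrite [in RHS](decomp f) [in RHS](decomp g); ring.
Qed.

End pair.
End IndependentProducts.

(** * Real inequalities for the exponential *)

Section RealInequalities.
Context {R : realType}.
Implicit Types x y r : R.

Lemma mulB1expR_le1 y : (1 - y) * expR y <= 1.
Proof.
have h : 1 - y <= expR (- y) by exact: expR_ge1Dx.
have := ler_wpM2r (expR_ge0 y) h.
by rewrite -expRD addNr expR0.
Qed.

(** For [-1 <= y] this is [(1 - y) * expR y <= 1] multiplied by [1 + y]; below
    [-1] the left-hand side is at most [1] and [- y <= y ^+ 2]. *)
Lemma expR_le_quadratic y : expR y <= 1 + y + y ^+ 2 * expR `|y|.
Proof.
have [y1|y1] := ltP y (-1).
  have ey1 : expR y <= 1 by rewrite -expR0 ler_expR; lra.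
  have y2 : - y <= y ^+ 2 by nra.
  have e1 : 1 <= expR `|y| by rewrite -expR0 ler_expR.
  have : y ^+ 2 <= y ^+ 2 * expR `|y| by rewrite ler_peMr// sqr_ge0.
  lra.
have h := mulB1expR_le1 y.
have : (1 + y) * ((1 - y) * expR y) <= (1 + y) * 1 by rewrite ler_wpM2l//; lra.
have : y ^+ 2 * expR y <= y ^+ 2 * expR `|y|.
  by rewrite ler_wpM2l ?sqr_ge0// ler_expR ler_norm.
lra.
Qed.

Lemma sqr_le_expR r : 0 <= r -> r ^+ 2 <= 16 * expR (r / 2).
Proof.
move=> r0; have h : 1 + r / 4 <= expR (r / 4) by exact: expR_ge1Dx.
have -> : expR (r / 2) = expR (r / 4) ^+ 2 by rewrite -expRM_natl; congr expR; lra.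
nra.
Qed.

(** Jensen for weights of total mass at most [1], the missing mass sitting at
    [0].  The proof sums the tangent inequality of [expR] at the barycentre. *)
Lemma expR_convex (I : finType) (w r : I -> R) :
  (forall i, 0 <= w i) -> \sum_i w i <= 1 ->
  expR (\sum_i w i * r i) <= \sum_i w i * expR (r i) + (1 - \sum_i w i).
Proof.
move=> w0; set m := \sum_i w i * r i; set W := \sum_i w i => W1.
(* the tangent of [expR] at [m], evaluated at [r i] *)
have tangent i : w i * (expR m * (1 + r i - m)) <= w i * expR (r i).
  rewrite ler_wpM2l// (_ : r i = m + (r i - m)); last by ring.
  rewrite expRD ler_wpM2l ?expR_ge0//.
  by rewrite -addrA; apply: (le_trans _ (expR_ge1Dx _)); lra.
have sumE : \sum_i w i * (expR m * (1 + r i - m)) = expR m * (W + m - W * m).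
  rewrite /W /m mulr_suml -big_split -sumrB/= mulr_sumr.
  by apply: eq_bigr => i _; ring.
have : \sum_i w i * (expR m * (1 + r i - m)) <= \sum_i w i * expR (r i).
  exact: ler_sum.
have : (1 - W) * ((1 - m) * expR m) <= (1 - W) * 1.
  by rewrite ler_wpM2l ?mulB1expR_le1// subr_ge0.
rewrite sumE; lra.
Qed.

(** A single term of the exponential series at [`|x|]. *)
Lemma pow_even_le_expR x m : x ^+ m.*2 / (m.*2)`!%:R <= expR x + expR (- x).
Proof.
have aux (z : R) : 0 <= z -> z ^+ m.*2 / (m.*2)`!%:R <= expR z.
  case: m => [|m] z0; first by rewrite expr0 fact0 divr1 -expR0 ler_expR.
  by have := expR_ge1Dxn (m.*2.+1) z0; rewrite doubleS; lra.
have evenN : x ^+ m.*2 = (- x) ^+ m.*2 by rewrite -mul2n !exprM sqrrN.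
have [x0|x0] := leP 0 x.
  by rewrite (le_trans (aux _ x0))// lerDl expR_ge0.
by rewrite evenN (le_trans (aux _ _)) ?lerDr ?expR_ge0//; lra.
Qed.

Lemma fact_double_le m : ((m.*2)`! <= m.*2 ^ m * m`!)%N.
Proof.
rewrite -(@ffact_fact m.*2 m) ?leq_double//; last by rewrite -addnn leq_addr.
have -> : (m.*2 - m = m)%N by rewrite -addnn addnK.
rewrite leq_mul2r; apply/orP; right.
by rewrite ffact_prod -[X in (_ <= _ ^ X)%N]card_ord -prod_nat_const leq_prod// => i _; rewrite leq_subr.
Qed.

End RealInequalities.

(** * Sub-Gaussian variables have a finite exponential square moment *)

Section OrliczNorms.
Context d (T : measurableType d) (R : realType) (P : probability T R).

(** The value [3 e] makes the series in [subgaussian_psi2] sum to [2] when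
    [K] is the sub-Gaussian parameter itself. *)
Definition psi2_const : R := 3 * expR 1.

Lemma psi2_const_gt0 : 0 < psi2_const.
Proof. by rewrite mulr_gt0// expR_gt0. Qed.

(** Up to the factor [sqrt psi2_const], the Orlicz norm of [U] for
    [exp (x^2) - 1] is at most [K].  Unlike the moment generating function, this
    bound makes sense for variables with a nonzero mean and behaves well under
    products. *)
Definition psi2 (U : T -> R) (K : R) :=
  measurable_fun setT U /\
  ('E_P[fun w => expR (U w ^+ 2 / (psi2_const * K ^+ 2))] <= 2%:E)%E.

(** The Orlicz norm of [W] for [exp x - 1] is at most [th]. *)
Definition psi1 (W : T -> R) (th : R) :=
  measurable_fun setT W /\ ('E_P[fun w => expR (`|W w| / th)] <= 2%:E)%E.

Lemma measurable_expR_comp (f : T -> R) :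
  measurable_fun setT f -> measurable_fun setT (fun w => expR (f w)).
Proof. by move=> mf; apply: measurableT_comp mf; exact: measurable_expR. Qed.

(** The even moment is bounded by the moment generating function at the points
    [l] and [- l], and [l = sqrt (2 m) / K] is the optimal choice. *)
Lemma subgaussian_moment_le (v : T -> R) (s K : R) m :
  subgaussian P v s -> 0 <= s -> s <= K -> 0 < K -> (0 < m)%N ->
  ('E_P[fun w => ((v w ^+ 2 / (psi2_const * K ^+ 2)) ^+ m / m`!%:R)%R] <=
   (2 * (3^-1) ^+ m)%:E)%E.
Proof.
move=> [mv _ mgf] s0 sK K0 m0.
pose l := Num.sqrt (m.*2%:R) / K.
have l0 : 0 < l by rewrite divr_gt0// sqrtr_gt0 ltr0n double_gt0.
have l2 : l ^+ 2 * K ^+ 2 = m.*2%:R.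
  by rewrite -exprMn /l divfK ?gt_eqF// sqr_sqrtr.
have mgfK t : ('E_P[fun w => expR (t * v w)] <= (expR (K ^+ 2 * t ^+ 2 / 2))%:E)%E.
  apply: (le_trans (mgf t)); rewrite lee_fin ler_expR.
  rewrite ler_pM2r// ler_wpM2r ?sqr_ge0// ler_pXn2r ?nnegrE//; exact: ltW.
have mexp t : measurable_fun setT (fun w => expR (t * v w)).
  by apply: measurable_expR_comp; exact: measurable_funM.
have a0 := psi2_const_gt0.
pose Y w := psi2_const ^- m * (expR (l * v w) + expR (- l * v w)).
apply: (@le_trans _ _ 'E_P[Y]%E).
  apply: ge0_le_expectation.
  - apply: measurable_funM => //; apply: measurable_funX.
    by apply: measurable_funM => //; exact: measurable_funX.
  - by apply: measurable_funM => //; exact: measurable_funD.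
  move=> w; rewrite divr_ge0 ?exprn_ge0 ?divr_ge0 ?sqr_ge0//=; last first.
    by rewrite mulr_ge0 ?sqr_ge0// ltW.
  have := pow_even_le_expR (l * v w) m; rewrite -mulNr => h.
  apply: (@le_trans _ _ (psi2_const ^- m * ((l * v w) ^+ m.*2 / (m.*2)`!%:R))); last first.
    by rewrite ler_wpM2l// invr_ge0 exprn_ge0// ltW.
  have -> : v w ^+ 2 / (psi2_const * K ^+ 2) = psi2_const^-1 * ((l * v w) ^+ 2 / m.*2%:R).
    rewrite -l2 exprMn; field.
    by apply/and3P; split; apply/eqP/nesym/eqP; rewrite lt_eqF.
  rewrite -mul2n (exprM _ 2 m) exprMn exprVn -mulrA ler_wpM2l//.
    by rewrite invr_ge0 exprn_ge0// ltW.
  rewrite expr_div_n -mulrA; apply: ler_wpM2l.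
    by apply: exprn_ge0; exact: sqr_ge0.
  rewrite -natrX -invfM -natrM lef_pV2 ?posrE ?ltr0n ?fact_gt0//.
    rewrite ler_nat; have := fact_double_le m; rewrite -mul2n. by [].
  by rewrite muln_gt0 expn_gt0 fact_gt0 muln_gt0 m0.
rewrite ge0_expectationZl; last 3 first.
- exact: measurable_funD.
- by move=> w; rewrite addr_ge0 ?expR_ge0.
- by rewrite invr_ge0 exprn_ge0// ltW.
rewrite ge0_expectationD//; [|by move=> w; exact: expR_ge0..].
have -> : 2 * (3^-1) ^+ m = psi2_const ^- m * (expR m%:R + expR m%:R) :> R.
  have -> : expR m%:R = expR 1 ^+ m :> R by rewrite -expRM_natl mulr1.
  rewrite /psi2_const exprMn exprVn; field.
  by rewrite !expf_neq0// gt_eqF// expR_gt0.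
rewrite EFinM EFinD lee_wpmul2l//; first by rewrite lee_fin invr_ge0 exprn_ge0// ltW.
have half : K ^+ 2 * l ^+ 2 / 2 = m%:R.
  by rewrite mulrC [K ^+ 2 * _]mulrC l2 -mul2n natrM mulKf.
by apply: leeD; rewrite -half ?(le_trans (mgfK _))// sqrrN.
Qed.

(** Expand the exponential in series: the term of order [m >= 1] has
    expectation at most [2 / 3 ^ m], which sums to [1] and adds to the term [1]
    of order [0]. *)
Lemma subgaussian_psi2 (v : T -> R) (s K : R) :
  subgaussian P v s -> 0 <= s -> s <= K -> 0 < K -> psi2 v K.
Proof.
move=> sv s0 sK K0; have mv : measurable_fun setT v by case: sv.
split=> //.
pose u w := v w ^+ 2 / (psi2_const * K ^+ 2).
have u0 w : 0 <= u w.
  by rewrite divr_ge0 ?sqr_ge0// mulr_ge0 ?sqr_ge0// ltW// psi2_const_gt0.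
have mu : measurable_fun setT u.
  by apply: measurable_funM => //; exact: measurable_funX.
pose f m w := (u w ^+ m / m`!%:R)%:E.
have f0 m w : (0 <= f m w)%E by rewrite lee_fin divr_ge0 ?exprn_ge0.
have series w : (expR (u w))%:E = (\sum_(0 <= m <oo) f m w)%E.
  rewrite /expR -EFin_lim; last exact: is_cvg_series_exp_coeff.
  by congr (limn _); apply/funext => m /=; rewrite /series/= sumEFin.
rewrite expectationE; under eq_integral do rewrite series.
rewrite integral_nneseries//; last first.
  move=> m; apply/measurable_EFinP/measurable_funM => //.
  exact: measurable_funX.
have term m : (\int[P]_w f m w <= (if m == 0 then 1 else 2 * (3^-1) ^+ m)%:E)%E.
  have [->|m0] := eqVneq m 0%N.
    rewrite (eq_integral (cst 1%E)).
      by rewrite integral_cst// mul1e; exact: probability_le1.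
    by move=> w _; rewrite /f expr0 fact0 divr1.
  have m1 : (0 < m)%N by rewrite lt0n.
  rewrite -expectationE; exact: subgaussian_moment_le sv s0 sK K0 m1.
apply: lime_le; first by apply: is_cvg_nneseries => m _ _; exact: integral_ge0.
exists 1%N => // -[//|n] _ /=.
(* the partial sums of [1 + 2/3 + 2/9 + ...] are [2 - 3 ^- n] *)
apply: (@le_trans _ _ (2 - (3^-1) ^+ n)%:E); last first.
  by rewrite lee_fin gerBl exprn_ge0.
elim: n => [|n IH].
  by rewrite big_nat1 expr0 (le_trans (term _))//= lee_fin; lra.
rewrite big_nat_recr//= (le_trans (leeD IH (term _)))//= -EFinD lee_fin !exprS.
lra.
Qed.

End OrliczNorms.

(** * Calculus of sub-Gaussian and sub-exponential scales *)

Section OrliczCalculus.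
Context d (T : measurableType d) (R : realType) (P : probability T R).

Lemma psi2Z (U : T -> R) (K K' c : R) :
  psi2 P U K -> 0 < K -> 0 < K' -> `|c| * K <= K' ->
  psi2 P (fun w => c * U w) K'.
Proof.
move=> [mU EU] K0 K'0 cK; have a0 := psi2_const_gt0 R.
have mexp2 (V : T -> R) L : measurable_fun setT V ->
    measurable_fun setT (fun w => expR (V w ^+ 2 / (psi2_const R * L ^+ 2))).
  move=> mV; apply: measurable_expR_comp; apply: measurable_funM => //.
  exact: measurable_funX.
have mcU : measurable_fun setT (fun w => c * U w) by exact: measurable_funM.
split=> //; apply: le_trans EU; apply: ge0_le_expectation; [exact: mexp2..|].
move=> w; rewrite expR_ge0/= ler_expR.
rewrite ler_pdivrMr ?mulr_gt0 ?exprn_gt0// mulrAC ler_pdivlMr ?mulr_gt0 ?exprn_gt0//.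
have : (c * K) ^+ 2 <= K' ^+ 2.
  rewrite -real_normK ?num_real// normrM (gtr0_norm K0).
  by rewrite ler_pXn2r ?nnegrE ?mulr_ge0 ?(ltW K0) ?(ltW K'0).
move=> h; have := ler_wpM2l (mulr_ge0 (ltW a0) (sqr_ge0 (U w))) h.
rewrite !exprMn; lra.
Qed.

(** By the inequality [2 x y <= x^2 + y^2] and convexity, the exponential of the
    product is at most the average of the two exponentials of squares. *)
Lemma psi1_mul (U V : T -> R) (K L : R) :
  psi2 P U K -> psi2 P V L -> 0 < K -> 0 < L ->
  psi1 P (fun w => U w * V w) (psi2_const R * (K * L)).
Proof.
move=> [mU EU] [mV EV] K0 L0; have a0 := psi2_const_gt0 R.
have mUV : measurable_fun setT (fun w => U w * V w) by exact: measurable_funM.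
split=> //.
pose x w := U w ^+ 2 / (psi2_const R * K ^+ 2).
pose y w := V w ^+ 2 / (psi2_const R * L ^+ 2).
have mx : measurable_fun setT (fun w => expR (x w)).
  apply: measurable_expR_comp; apply: measurable_funM => //.
  exact: measurable_funX.
have my : measurable_fun setT (fun w => expR (y w)).
  apply: measurable_expR_comp; apply: measurable_funM => //.
  exact: measurable_funX.
apply: (@le_trans _ _ 'E_P[fun w => (2^-1 * (expR (x w) + expR (y w)))%R]%E).
  apply: ge0_le_expectation.
  - apply: measurable_expR_comp; apply: measurable_funM => //.
    exact: measurableT_comp.
  - by apply: measurable_funM => //; exact: measurable_funD.
  move=> w; rewrite expR_ge0/=.
  apply: (@le_trans _ _ (expR (2^-1 * (x w + y w)))).
    rewrite ler_expR /x /y normrM.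
    set u := `|U w| / K; set v := `|V w| / L.
    rewrite -(real_normK (num_real (U w))) -(real_normK (num_real (V w))).
    have -> : `|U w| * `|V w| / (psi2_const R * (K * L)) = (psi2_const R)^-1 * (u * v).
      by rewrite /u /v; field; rewrite !gt_eqF.
    have -> : 2^-1 * (`|U w| ^+ 2 / (psi2_const R * K ^+ 2) +
        `|V w| ^+ 2 / (psi2_const R * L ^+ 2)) =
        (psi2_const R)^-1 * (2^-1 * (u ^+ 2 + v ^+ 2)).
      by rewrite /u /v; field; rewrite !gt_eqF.
    rewrite ler_wpM2l ?invr_ge0 ?(ltW a0)//.
    have := sqr_ge0 (u - v); rewrite sqrrB; lra.
  have half (z : R) : expR z = expR (2^-1 * z) ^+ 2.
    by rewrite -expRM_natl; congr expR; lra.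
  rewrite mulrDr expRD (half (x w)) (half (y w)).
  by have := sqr_ge0 (expR (2^-1 * x w) - expR (2^-1 * y w)); rewrite sqrrB; lra.
rewrite ge0_expectationZl//; last exact: measurable_funD.
rewrite ge0_expectationD//.
apply: (@le_trans _ _ ((2^-1 : R)%:E * (2%:E + 2%:E))%E).
  by rewrite lee_wpmul2l ?lee_fin// leeD.
by rewrite -EFinD -EFinM lee_fin; lra.
Qed.

(** Each [`|c i| * th i / Th] is a weight in [expR_convex]. *)
Lemma psi1_lincomb (I : finType) (W : I -> T -> R) (c th : I -> R) (Th : R) :
  (forall i, psi1 P (W i) (th i)) -> (forall i, 0 < th i) -> 0 < Th ->
  \sum_i `|c i| * th i <= Th ->
  psi1 P (fun w => \sum_i c i * W i w) Th.
Proof.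
move=> pW th0 Th0 cth.
have mW i : measurable_fun setT (W i) by case: (pW i).
have mS : measurable_fun setT (fun w => \sum_i c i * W i w).
  by apply: measurable_sum => i; exact: measurable_funM.
split=> //.
pose q i := `|c i| * th i / Th.
have q0 i : 0 <= q i by rewrite divr_ge0 ?mulr_ge0// ltW.
have q1 : \sum_i q i <= 1 by rewrite -mulr_suml ler_pdivrMr// mul1r.
pose g i w := expR (`|W i w| / th i).
have mg i : measurable_fun setT (g i).
  apply: measurable_expR_comp; apply: measurable_funM => //.
  exact: measurableT_comp.
have mqg i : measurable_fun setT (fun w => q i * g i w) by exact: measurable_funM.
have qg0 i w : 0 <= q i * g i w by rewrite mulr_ge0 ?expR_ge0.
apply: (@le_trans _ _ 'E_P[fun w => (\sum_i q i * g i w + (1 - \sum_i q i))%R]%E).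
  apply: ge0_le_expectation.
  - apply: measurable_expR_comp; apply: measurable_funM => //.
    exact: measurableT_comp.
  - by apply: measurable_funD => //; exact: measurable_sum.
  move=> w; rewrite expR_ge0/=; apply: le_trans (expR_convex _ q0 q1).
  rewrite ler_expR ler_pdivrMr// (le_trans (ler_norm_sum _ _ _))// mulr_suml.
  apply: ler_sum => i _; rewrite normrM /q le_eqVlt; apply/orP; left; apply/eqP.
  by field; rewrite !gt_eqF.
rewrite ge0_expectationD//; last 3 first.
- exact: measurable_sum.
- by move=> w; rewrite sumr_ge0.
- by move=> w; rewrite subr_ge0.
rewrite ge0_expectation_sum// (expectation_cst P).
apply: (@le_trans _ _ ((\sum_i q i * 2)%:E + (1 - \sum_i q i)%:E)%E).
  rewrite leeD2r// -sumEFin; apply: lee_sum => i _.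
  rewrite ge0_expectationZl//; last by move=> w; exact: expR_ge0.
  by rewrite [leRHS]EFinM lee_wpmul2l ?lee_fin//; case: (pW i).
by rewrite -EFinD lee_fin -mulr_suml; lra.
Qed.

Lemma psi1_has_mean (W : T -> R) th : 0 < th -> psi1 P W th ->
  exists m, has_mean P W m.
Proof.
move=> th0 [mW EW]; have mn : measurable_fun setT (fun w => expR (`|W w| / th)).
  apply: measurable_expR_comp; apply: measurable_funM => //.
  exact: measurableT_comp.
apply: (@has_mean_bounded _ _ _ _ _ (fun w => th * expR (`|W w| / th))) => //.
- exact: measurable_funM.
- move=> w; rewrite mulrC -ler_pdivrMr//.
  by apply: le_trans (expR_ge1Dx _); rewrite lerDr.
rewrite ge0_expectationZl ?(ltW th0)//.
rewrite (@le_lt_trans _ _ (th%:E * 2%:E)%E)//; last by rewrite -EFinM ltry.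
by rewrite lee_wpmul2l// lee_fin ltW.
Qed.

Lemma psi2_has_mean (U : T -> R) K : 0 < K -> psi2 P U K -> exists m, has_mean P U m.
Proof.
move=> K0 [mU EU]; have a0 := psi2_const_gt0 R.
have aK0 : 0 < psi2_const R * K ^+ 2 by rewrite mulr_gt0 ?exprn_gt0.
pose q w := expR (U w ^+ 2 / (psi2_const R * K ^+ 2)).
have mq : measurable_fun setT q.
  by apply: measurable_expR_comp; apply: measurable_funM => //; exact: measurable_funX.
apply: (@has_mean_bounded _ _ _ _ _ (fun w => 1 + psi2_const R * K ^+ 2 * q w)) => //.
- by apply: measurable_funD => //; exact: measurable_funM.
- move=> w; apply: (@le_trans _ _ (1 + U w ^+ 2)).
    rewrite -real_normK ?num_real//.
    by have := sqr_ge0 (`|U w| - 2^-1); rewrite sqrrB; lra.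
  rewrite lerD2l mulrC -ler_pdivrMr//.
  by apply: le_trans (expR_ge1Dx _); rewrite lerDr.
rewrite ge0_expectationD//; last 2 first.
- exact: measurable_funM.
- by move=> w; rewrite mulr_ge0 ?expR_ge0 ?ltW.
have -> : ('E_P[fun=> 1%R] = 1)%E by exact: (expectation_cst P 1).
rewrite ge0_expectationZl ?(ltW aK0)//; last by move=> w; exact: expR_ge0.
apply: (@le_lt_trans _ _ (1 + (psi2_const R * K ^+ 2)%:E * 2%:E)%E).
  by rewrite leeD2l// lee_wpmul2l// lee_fin ltW.
by rewrite -EFinM -EFinD ltry.
Qed.

Lemma psi1D (V W : T -> R) s t : psi1 P V s -> psi1 P W t -> 0 < s -> 0 < t ->
  psi1 P (fun w => V w + W w) (s + t).
Proof.
move=> pV pW s0 t0.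
have := @psi1_lincomb bool (fun b => if b then V else W) (fun=> 1)
  (fun b => if b then s else t) (s + t).
rewrite big_bool/= normr1 !mul1r addr_gt0// lexx.
move=> /(_ _ _ isT isT); under eq_fun do rewrite big_bool/= !mul1r.
by apply; case.
Qed.

Lemma psi1Z (W : T -> R) t t' c : psi1 P W t -> 0 < t -> 0 < t' ->
  `|c| * t <= t' -> psi1 P (fun w => c * W w) t'.
Proof.
move=> pW t0 t'0 ct.
have := @psi1_lincomb unit (fun=> W) (fun=> c) (fun=> t) t'.
rewrite !big_const !card_unit/= addr0 => /(_ (fun=> pW) (fun=> t0) t'0 ct).
by under eq_fun do rewrite big_const card_unit/= addr0.
Qed.

(** In [exp y <= 1 + y + y^2 exp |y|] at [y = s W], half of the exponential
    moment absorbs [y^2] and the other half absorbs [exp |y|], since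
    [|s| th <= 1/2]. *)
Lemma psi1_mgf (W : T -> R) (th m s : R) :
  0 < th -> psi1 P W th -> has_mean P W m -> `|s| * th <= 2^-1 ->
  ('E_P[fun w => expR (s * W w)] <= (expR (s * m + 32 * (s * th) ^+ 2))%:E)%E.
Proof.
move=> th0 [mW EW] Wm sth.
have mn : measurable_fun setT (fun w => expR (`|W w| / th)).
  apply: measurable_expR_comp; apply: measurable_funM => //.
  exact: measurableT_comp.
have [e Ee] : exists e, has_mean P (fun w => expR (`|W w| / th)) e.
  apply: (has_mean_bounded mn mn _ (le_lt_trans EW (ltry _))) => w.
  by rewrite ger0_norm ?expR_ge0.
have e2 : e <= 2 by rewrite -lee_fin -Ee.2.
have k0 : 0 <= 16 * (s * th) ^+ 2 by rewrite mulr_ge0// sqr_ge0.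
have bound w : expR (s * W w) <=
    (1 + s * W w) + 16 * (s * th) ^+ 2 * expR (`|W w| / th).
  apply: (le_trans (expR_le_quadratic _)); rewrite lerD2l.
  set r := `|W w| / th; have r0 : 0 <= r by rewrite divr_ge0// ltW.
  have -> : (s * W w) ^+ 2 = (s * th) ^+ 2 * r ^+ 2.
    rewrite /r exprMn -(real_normK (num_real (W w))); field; rewrite gt_eqF//.
  have sW : `|s * W w| <= r / 2.
    rewrite normrM (_ : `|W w| = th * r); last by rewrite /r; field; rewrite gt_eqF.
    by rewrite mulrA mulrC ler_wpM2l.
  have -> : expR r = expR (r / 2) * expR (r / 2) by rewrite -expRD; congr expR; lra.
  have -> : 16 * (s * th) ^+ 2 * (expR (r / 2) * expR (r / 2)) =
    (s * th) ^+ 2 * (16 * expR (r / 2) * expR (r / 2)) by ring.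
  rewrite -mulrA ler_wpM2l ?sqr_ge0//.
  by rewrite ler_pM ?sqr_ge0 ?expR_ge0 ?sqr_le_expR// ler_expR.
have cst1 : has_mean P (cst 1) 1.
  split; last by rewrite (expectation_cst P 1).
  exact: (@finite_measure_integrable_cst _ _ _ P setT 1).
have := has_meanD (has_meanD cst1 (has_meanZ s Wm)) (has_meanZ (16 * (s * th) ^+ 2) Ee).
move=> [_ EY].
apply: (@le_trans _ _ (1 + s * m + 16 * (s * th) ^+ 2 * e)%:E).
  rewrite -EY; apply: ge0_le_expectation.
  - by apply: measurable_expR_comp; exact: measurable_funM.
  - apply: measurable_funD; last exact: measurable_funM.
    by apply: measurable_funD => //; exact: measurable_funM.
  by move=> w; rewrite expR_ge0/= bound.
rewrite lee_fin; apply: le_trans (expR_ge1Dx _).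
have := ler_wpM2l k0 e2; lra.
Qed.

End OrliczCalculus.

(** * Bernstein tail bound for sub-exponential sums *)

Section Bernstein.
Context d (T : measurableType d) (R : realType) (P : probability T R).
Context (n : nat) (G : 'I_n -> set (set T)).

(** Chernoff with [s = t n / (64 th)], the minimizer of the exponent
    [32 s^2 th^2 / n - s t th]; the restriction [t <= 32] is what keeps [s] in
    the range of [psi1_mgf]. *)
Lemma bernstein_upper (W : 'I_n -> T -> R) (m : 'I_n -> R) (th t : R) :
  independent_pi_systems P G -> (0 < n)%N -> 0 < th -> 0 <= t <= 32 ->
  (forall i, measurable_fun [set: g_sigma_algebraType (G i)] (W i)) ->
  (forall i, psi1 P (W i) (th / n%:R)) -> (forall i, has_mean P (W i) (m i)) ->
  (P [set w | (t * th <= \sum_i W i w - \sum_i m i)%R] <=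
   (expR (- (n%:R * t ^+ 2 / 128)))%:E)%E.
Proof.
move=> Gind n0 th0 /andP[t0 t32] mW pW Wm; have [Gm _ _ _] := Gind.
have nR0 : 0 < n%:R :> R by rewrite ltr0n.
have mTW i : measurable_fun [set: T] (W i) by exact: (measurable_fun_sub_sigma (Gm i)).
have mS : measurable_fun [set: T] (fun w => \sum_i W i w) by exact: measurable_sum.
pose s := t * n%:R / (64 * th).
have s0 : 0 <= s by rewrite divr_ge0 ?mulr_ge0// ltW.
have thn0 : 0 < th / n%:R by rewrite divr_gt0.
have sth : `|s| * (th / n%:R) <= 2^-1.
  have -> : `|s| * (th / n%:R) = t / 64.
    by rewrite ger0_norm// /s; field; rewrite !gt_eqF.
  lra.
have mgf i := psi1_mgf thn0 (pW i) (Wm i) sth.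
pose e i := fine 'E_P[fun w => expR (s * W i w)].
have e0 i : 0 <= e i by rewrite fine_ge0// expectation_ge0// => w; exact: expR_ge0.
have Ee i : ('E_P[fun w => expR (s * W i w)] = (e i)%:E)%E.
  rewrite fineK// ge0_fin_numE ?(le_lt_trans (mgf i)) ?ltry//.
  by apply: expectation_ge0 => w; exact: expR_ge0.
have ele i : e i <= expR (s * m i + 32 * (s * (th / n%:R)) ^+ 2).
  by rewrite -lee_fin -Ee; exact: mgf.
have mexp i : measurable_fun [set: g_sigma_algebraType (G i)] (fun w => expR (s * W i w)).
  apply: measurableT_comp; first exact: measurable_expR.
  exact: measurable_funM.
have prodE := expectation_prod Gind mexp (fun i w => expR_ge0 _) Ee.
set mu := \sum_i m i.
pose Y w := expR (- (s * (mu + t * th))) * \prod_i expR (s * W i w).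
have mprod : measurable_fun [set: T] (fun w => \prod_i expR (s * W i w)).
  by apply: measurable_prod => i _; apply: measurable_expR_comp; exact: measurable_funM.
have YE w : Y w = expR (s * (\sum_i W i w - mu - t * th)).
  rewrite /Y -expR_sum -expRD; congr expR; rewrite -mulr_sumr; ring.
have mA : measurable [set w | t * th <= \sum_i W i w - mu].
  rewrite -[X in measurable X]setTI; apply: (measurable_fun_le (f := cst _)) => //.
  exact: measurable_funB.
rewrite -expectation_indic//.
apply: (@le_trans _ _ 'E_P[Y]%E).
  apply: ge0_le_expectation.
  - exact: measurable_indic.
  - exact: measurable_funM.
  move=> w; rewrite indicE ler0n/=.
  have [/[!inE]/= wA|_] := boolP (w \in _); last by rewrite YE expR_ge0.
  by rewrite YE -expR0 ler_expR mulr_ge0// subr_ge0.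
rewrite ge0_expectationZl//; last by move=> w; rewrite prodr_ge0// => i _; exact: expR_ge0.
rewrite prodE -EFinM lee_fin.
apply: (@le_trans _ _ (expR (- (s * (mu + t * th))) *
    \prod_i expR (s * m i + 32 * (s * (th / n%:R)) ^+ 2))).
  rewrite ler_wpM2l ?expR_ge0// ler_prod// => i _.
  by rewrite e0 ele.
rewrite -expR_sum -expRD ler_expR big_split/= -mulr_sumr -/mu sumr_const card_ord.
rewrite -mulr_natr /s le_eqVlt; apply/orP; left; apply/eqP.
by field; rewrite !gt_eqF.
Qed.

Lemma bernstein (W : 'I_n -> T -> R) (m : 'I_n -> R) (th t : R) :
  independent_pi_systems P G -> (0 < n)%N -> 0 < th -> 0 <= t <= 32 ->
  (forall i, measurable_fun [set: g_sigma_algebraType (G i)] (W i)) ->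
  (forall i, psi1 P (W i) (th / n%:R)) -> (forall i, has_mean P (W i) (m i)) ->
  (P [set w | (t * th <= `|\sum_i W i w - \sum_i m i|)%R] <=
   (2 * expR (- (n%:R * t ^+ 2 / 128)))%:E)%E.
Proof.
move=> Gind n0 th0 t32 mW pW Wm; have [Gm _ _ _] := Gind.
have mTW i : measurable_fun [set: T] (W i) by exact: (measurable_fun_sub_sigma (Gm i)).
have mS : measurable_fun [set: T] (fun w => \sum_i W i w) by exact: measurable_sum.
have up := bernstein_upper Gind n0 th0 t32 mW pW Wm.
have mWN i : measurable_fun [set: g_sigma_algebraType (G i)] (fun w => -1 * W i w).
  exact: measurable_funM.
have pWN i : psi1 P (fun w => -1 * W i w) (th / n%:R).
  have [mWi EWi] := pW i; split; first exact: measurable_funM.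
  by under eq_fun do rewrite mulN1r normrN.
have WNm i := has_meanZ (-1) (Wm i).
have down := bernstein_upper Gind n0 th0 t32 mWN pWN WNm.
have mA : measurable [set w | t * th <= \sum_i W i w - \sum_i m i].
  rewrite -[X in measurable X]setTI; apply: (measurable_fun_le (f := cst _)) => //.
  exact: measurable_funB.
have mB : measurable [set w | t * th <= \sum_i -1 * W i w - \sum_i -1 * m i].
  rewrite -[X in measurable X]setTI; apply: (measurable_fun_le (f := cst _)) => //.
  apply: measurable_funB => //; apply: measurable_sum => i; exact: measurable_funM.
have -> : [set w | t * th <= `|\sum_i W i w - \sum_i m i|] =
    [set w | t * th <= \sum_i W i w - \sum_i m i] `|`
    [set w | t * th <= \sum_i -1 * W i w - \sum_i -1 * m i].
  apply/seteqP; split => w /=; rewrite -!mulr_sumr -mulrBr mulN1r ler_normr.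
    by case/orP; [left|right].
  by case=> ->; rewrite ?orbT.
apply: (le_trans (measureU2 _ _ _)) => //.
by rewrite mulr_natl mulr2n EFinD leeD.
Qed.

End Bernstein.

(** * Quadratic forms and the smallest eigenvalue *)

Section QuadraticForms.
Context {R : realType}.

Definition qform k (A : 'M[R]_k) (u : 'cV[R]_k) : R := (u^T *m A *m u) 0 0.
Definition sqnorm k (u : 'cV[R]_k) : R := \sum_i u i 0 ^+ 2.

Lemma bformE k (A : 'M[R]_k) (u v : 'cV[R]_k) :
  (u^T *m A *m v) 0 0 = \sum_i \sum_j u i 0 * A i j * v j 0.
Proof.
rewrite mxE exchange_big; apply: eq_bigr => j _.
by rewrite mxE mulr_suml; apply: eq_bigr => i _; rewrite mxE.
Qed.

Lemma qformE k (A : 'M[R]_k) u : qform A u = \sum_i \sum_j u i 0 * A i j * u j 0.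
Proof. exact: bformE. Qed.

Lemma qform_subZ k (A : 'M[R]_k) (u v : 'cV[R]_k) t :
  qform A (u - t *: v) = qform A u -
    t * ((u^T *m A *m v) 0 0 + (v^T *m A *m u) 0 0) + t ^+ 2 * qform A v.
Proof.
rewrite !bformE !qformE -big_split/= !mulr_sumr -sumrB -big_split/=.
apply: eq_bigr => i _; rewrite -big_split/= !mulr_sumr -sumrB -big_split/=.
by apply: eq_bigr => j _; rewrite !mxE; ring.
Qed.

Lemma qformB k (A B : 'M[R]_k) u : qform (A - B) u = qform A u - qform B u.
Proof. by rewrite /qform mulmxBr mulmxBl !mxE. Qed.

Lemma qform_scalar k (a : R) (u : 'cV[R]_k) : qform a%:M u = a * sqnorm u.
Proof.
rewrite /qform mul_mx_scalar -scalemxAl mxE [in LHS]mxE; congr (_ * _).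
by apply: eq_bigr => i _; rewrite mxE expr2.
Qed.

Lemma qformZ k (A : 'M[R]_k) a u : qform A (a *: u) = a ^+ 2 * qform A u.
Proof.
rewrite !qformE mulr_sumr; apply: eq_bigr => i _; rewrite mulr_sumr.
by apply: eq_bigr => j _; rewrite !mxE; ring.
Qed.

Lemma sqnormZ k a (u : 'cV[R]_k) : sqnorm (a *: u) = a ^+ 2 * sqnorm u.
Proof. by rewrite /sqnorm mulr_sumr; apply: eq_bigr => i _; rewrite mxE exprMn. Qed.

Lemma sqnorm_ge0 k (u : 'cV[R]_k) : 0 <= sqnorm u.
Proof. by apply: sumr_ge0 => i _; exact: sqr_ge0. Qed.

Lemma sqnorm_gt0 k (u : 'cV[R]_k) : u != 0 -> 0 < sqnorm u.
Proof.
move=> u0; rewrite lt_neqAle sqnorm_ge0 andbT eq_sym; apply: contra u0.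
rewrite psumr_eq0//; last by move=> i _; exact: sqr_ge0.
move=> /allP uz; apply/eqP/colP => i; rewrite mxE.
by have /implyP/(_ isT) := uz i (mem_index_enum i); rewrite sqrf_eq0 => /eqP.
Qed.

Lemma l2normE k (u : 'cV[R]_k) : l2norm u = Num.sqrt (sqnorm u).
Proof. by []. Qed.

Lemma sqnorm_le1 k (u : 'cV[R]_k) i : sqnorm u <= 1 -> `|u i 0| <= 1.
Proof.
move=> u1; rewrite -(@ler_pXn2r _ 2)// ?nnegrE// expr1n real_normK ?num_real//.
apply: le_trans u1; rewrite /sqnorm (bigD1 i)//= lerDl sumr_ge0// => j _.
exact: sqr_ge0.
Qed.

Lemma qform_norm_le k (A : 'M[R]_k) u : sqnorm u <= 1 ->
  `|qform A u| <= \sum_i \sum_j `|A i j|.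
Proof.
move=> u1; rewrite qformE (le_trans (ler_norm_sum _ _ _))//.
apply: ler_sum => i _; rewrite (le_trans (ler_norm_sum _ _ _))//.
apply: ler_sum => j _; rewrite !normrM mulrAC.
by rewrite ler_piMl// mulr_ile1// sqnorm_le1.
Qed.

Lemma sqnorm_delta k (j : 'I_k) : sqnorm (delta_mx j 0 : 'cV[R]_k) = 1.
Proof.
rewrite /sqnorm (bigD1 j)//= big1 ?mxE ?eqxx ?expr1n ?addr0// => l lj.
by rewrite mxE (negbTE lj) expr0n.
Qed.

Lemma normalize k (u : 'cV[R]_k) : u != 0 ->
  exists2 v, sqnorm v = 1 & exists2 a, 0 < a & u = a *: v.
Proof.
move=> u0; have s0 := sqnorm_gt0 u0.
have a0 : 0 < Num.sqrt (sqnorm u) by rewrite sqrtr_gt0.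
exists ((Num.sqrt (sqnorm u))^-1 *: u).
  by rewrite sqnormZ exprVn sqr_sqrtr ?mulVf ?gt_eqF// ltW.
by exists (Num.sqrt (sqnorm u)); rewrite // scalerA mulfV ?scale1r// gt_eqF.
Qed.

Lemma qform_ge_scale k (A : 'M[R]_k) (mu : R) :
  (forall v, sqnorm v = 1 -> mu <= qform A v) ->
  forall u, mu * sqnorm u <= qform A u.
Proof.
move=> H u; have [->|/normalize[v v1 [a a0 ->]]] := eqVneq u 0.
  rewrite -(scale0r (0 : 'cV_k)) qformZ sqnormZ; lra.
by rewrite qformZ sqnormZ v1 mulr1 mulrC ler_wpM2l ?sqr_ge0// H.
Qed.

(** A positive semidefinite form vanishes only on the kernel.  Quantitatively,
    evaluating the form at [u - t *: (invmx B *m u)] gives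
    [0 <= qform B u - 2 t + t^2 qform (invmx B) u] for a unit vector [u]; take
    for [t] the inverse of an upper bound of [qform (invmx B)]. *)
Lemma psd_unit_bounded k (B : 'M[R]_k) : B^T = B -> B \in unitmx ->
  (forall u, 0 <= qform B u) ->
  exists2 eps, 0 < eps & forall u, sqnorm u = 1 -> eps <= qform B u.
Proof.
(* adding [1] makes the bound positive *)
move=> Bs Bu B0; pose N := 1 + \sum_i \sum_j `|invmx B i j|.
have N0 : 0 < N by rewrite ltr_pwDl// sumr_ge0// => i _; rewrite sumr_ge0.
exists N^-1; rewrite ?invr_gt0// => u u1.
pose v := invmx B *m u.
have Bv : B *m v = u by rewrite /v mulKVmx.
have uBv : u^T *m B *m v = (sqnorm u)%:M.
  apply/matrixP => i j; rewrite !ord1 -mulmxA Bv !mxE eqxx mulr1n.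
  by apply: eq_bigr => l _; rewrite mxE expr2.
have vBu : v^T *m B *m u = (sqnorm u)%:M.
  by apply: trmx_inj; rewrite 2!trmx_mul trmxK Bs mulmxA uBv tr_scalar_mx.
have qv : qform B v = qform (invmx B) u.
  rewrite /qform -mulmxA Bv /v trmx_mul trmx_inv Bs.
  by [].
have := B0 (u - N^-1 *: v).
rewrite qform_subZ uBv vBu u1 qv !mxE eqxx mulr1n.
have := qform_norm_le (invmx B) (_ : sqnorm u <= 1); rewrite u1 lexx => /(_ isT).
move=> /ler_normlW qN.
have qN' : qform (invmx B) u <= N by rewrite (le_trans qN)// lerDr.
have : N^-1 * (N^-1 * qform (invmx B) u) <= N^-1 * (N^-1 * N).
  by rewrite !ler_wpM2l// invr_ge0 ltW.
rewrite mulVf ?gt_eqF//; lra.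
Qed.

(** Let [mu] be the infimum of the Rayleigh quotient.  It bounds all
    eigenvalues from below, and it is itself an eigenvalue: otherwise [S - mu]
    would be positive semidefinite and invertible, hence bounded below by
    [psd_unit_bounded], and [mu] could be increased. *)
Lemma lambda_min_qform k (S : 'M[R]_k) u : S^T = S ->
  lambda_min S * sqnorm u <= qform S u.
Proof.
move=> Ss.
have [->|/normalize[v0 v01 _]] := eqVneq u 0.
  rewrite -(scale0r (0 : 'cV_k)) qformZ sqnormZ; lra.
pose Q := [set qform S v | v in [set v | sqnorm v = 1]].
pose mu := inf Q.
have Q0 : Q !=set0 by exists (qform S v0), v0.
have Qlb : has_lbound Q.
  exists (- \sum_i \sum_j `|S i j|) => _ [v /= v1 <-].
  have := qform_norm_le S (_ : sqnorm v <= 1); rewrite v1 lexx => /(_ isT).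
  by rewrite ler_norml => /andP[].
have muQ v : sqnorm v = 1 -> mu <= qform S v by move=> v1; apply: ge_inf => //; exists v.
have {}muQ := qform_ge_scale muQ.
apply: le_trans (muQ u); rewrite ler_wpM2r ?sqnorm_ge0//.
apply: ge_inf.
  exists mu => a /eigenvalueP[v vS v0n].
  have w0 : v^T != 0 by rewrite trmx_eq0.
  have : qform S v^T = a * sqnorm v^T.
    rewrite /qform trmxK vS -scalemxAl mxE; congr (_ * _); rewrite mxE.
    by apply: eq_bigr => i _; rewrite mxE expr2.
  by move: (muQ v^T) => /[swap] ->; rewrite ler_pM2r// sqnorm_gt0.
pose B := S - mu%:M.
have Bs : B^T = B by rewrite /B linearB/= tr_scalar_mx Ss.
have B0 v : 0 <= qform B v by rewrite qformB qform_scalar subr_ge0.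
have Bn : B \notin unitmx.
  apply/negP => Bu; have [eps e0 He] := psd_unit_bounded Bs Bu B0.
  suff : mu + eps <= mu by lra.
  apply: lb_le_inf => // _ [v /= v1 <-].
  by have := He v v1; rewrite qformB qform_scalar v1; lra.
rewrite /= /eigenvalue /eigenspace -/B.
by rewrite kermx_eq0 row_free_unit.
Qed.

End QuadraticForms.

(** * Quadratic forms on a grid, and linear systems *)

Section Grid.
Context {R : realType}.

(** The value [m] of an index encodes the coordinate [0], so that the
    coordinates range over the multiples of [1 / m] in [[-1, 1]]. *)
Definition gridvec k m (g : {ffun 'I_k -> 'I_m.*2.+1}) : 'cV[R]_k :=
  \col_i (((g i)%:R - m%:R) / m%:R).

(** Rounding is towards [0], so that the norm does not increase. *)
Lemma round_to_grid m (x : R) : (0 < m)%N -> `|x| <= 1 ->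
  exists j : 'I_m.*2.+1, let y := (j%:R - m%:R) / m%:R in
    `|y| <= `|x| /\ `|x - y| <= m%:R^-1.
Proof.
move=> m0 x1; have mR : 0 < m%:R :> R by rewrite ltr0n.
pose z := Num.truncn (m%:R * `|x|).
have mx0 : 0 <= m%:R * `|x| by rewrite mulr_ge0.
have /andP[z1 z2] : z%:R <= m%:R * `|x| < z.+1%:R.
  by rewrite truncn_itv.
have zm : (z <= m)%N.
  rewrite -(ler_nat R) (le_trans z1)// ler_piMr//.
have zx : z%:R / m%:R <= `|x| by rewrite ler_pdivrMr// mulrC.
have xz : `|x| - z%:R / m%:R <= m%:R^-1.
  rewrite lerBlDr -(ler_pM2l mR) mulrDr mulrCA mulfV ?gt_eqF// mulr1.
  by rewrite nat1r ltW.
have zm0 : 0 <= z%:R / m%:R :> R by rewrite divr_ge0.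
have [x0|x0] := leP 0 x.
  exists (inord (m + z)) => /=.
  rewrite inordK; last by rewrite ltnS -addnn leq_add2l.
  have -> : ((m + z)%:R - m%:R) / m%:R = z%:R / m%:R :> R by rewrite natrD addrAC subrr add0r.
  rewrite (ger0_norm x0) in zx xz *.
  by rewrite !ger0_norm// subr_ge0.
exists (inord (m - z)) => /=.
rewrite inordK; last by rewrite ltnS -addnn (leq_trans (leq_subr _ _))// leq_addr.
have -> : ((m - z)%:R - m%:R) / m%:R = - (z%:R / m%:R) :> R.
  by rewrite natrB// addrAC subrr add0r mulNr.
rewrite (ltr0_norm x0) in zx xz *.
rewrite normrN opprK (ger0_norm zm0); split=> //.
by rewrite ler0_norm; lra.
Qed.

(** The bound is uniform in [A]: a product of two coordinates in [[-1, 1]] moves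
    by at most [2 / m]. *)
Lemma grid_approx k m (u : 'cV[R]_k) : (0 < m)%N -> sqnorm u = 1 ->
  exists g : {ffun 'I_k -> 'I_m.*2.+1}, sqnorm (gridvec g) <= 1 /\
    forall A : 'M[R]_k, `|qform A u - qform A (gridvec g)| <=
      2 / m%:R * \sum_i \sum_j `|A i j|.
Proof.
move=> m0 u1; have mR : 0 < m%:R :> R by rewrite ltr0n.
have u_le i : `|u i 0| <= 1 by apply: sqnorm_le1; rewrite u1.
have /choice[g Hg] := fun i => round_to_grid m0 (u_le i).
exists [ffun i => g i]; set y := gridvec _.
have yE i : y i 0 = ((g i)%:R - m%:R) / m%:R by rewrite mxE ffunE.
have y1 i : `|y i 0| <= `|u i 0| by rewrite yE; case: (Hg i).
have y2 i : `|u i 0 - y i 0| <= m%:R^-1 by rewrite yE; case: (Hg i).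
split=> [|A].
  rewrite -u1; apply: ler_sum => i _.
  rewrite -(real_normK (num_real (y i 0))) -(real_normK (num_real (u i 0))).
  by rewrite ler_pXn2r ?nnegrE.
rewrite !qformE -sumrB; under eq_bigr do rewrite -sumrB.
rewrite mulr_sumr (le_trans (ler_norm_sum _ _ _))//; apply: ler_sum => i _.
rewrite mulr_sumr (le_trans (ler_norm_sum _ _ _))//; apply: ler_sum => j _.
have -> : u i 0 * A i j * u j 0 - y i 0 * A i j * y j 0 =
  (u i 0 * (u j 0 - y j 0) + (u i 0 - y i 0) * y j 0) * A i j by ring.
rewrite normrM ler_wpM2r// (le_trans (ler_normD _ _))// !normrM.
rewrite mulr_natl mulr2n; apply: lerD.
  by rewrite (le_trans (ler_piMl _ (u_le i))).
by rewrite (le_trans (ler_piMr _ (le_trans (y1 j) (u_le j)))).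
Qed.

(** The vectors [(e_j + e_l) / 2] and [(e_j - e_l) / 2] belong to the grid, so
    polarization bounds the entries of [A] by [2 delta].  The mesh
    [1 / (4 k^2)] is then fine enough for rounding a unit vector to cost at most
    [delta] more. *)
Lemma qform_le_grid k (A : 'M[R]_k) (delta : R) : A^T = A -> (0 < k)%N ->
  (forall g : {ffun 'I_k -> 'I_(4 * k ^ 2).*2.+1},
    sqnorm (gridvec g) <= 1 -> `|qform A (gridvec g)| <= delta) ->
  forall u, `|qform A u| <= 2 * delta * sqnorm u.
Proof.
move=> As k0 Hgrid; set m := (4 * k ^ 2)%N in Hgrid *.
have kR : 0 < k%:R :> R by rewrite ltr0n.
have m0 : (0 < m)%N by rewrite muln_gt0 expn_gt0 k0.
have mR : 0 < m%:R :> R by rewrite ltr0n.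
have mE : m%:R = 4 * k%:R ^+ 2 :> R by rewrite natrM natrX.
(* [h] steps of the grid make a coordinate [1/2] *)
pose h := (2 * k ^ 2)%N.
have hE : h%:R = m%:R / 2 :> R by rewrite mE natrM natrX; field.
have mh : m = (h + h)%N by rewrite /m /h -mulnDl.
clearbody h m.
pose ep j l : 'cV[R]_k := \col_i (((i == j)%:R + (i == l)%:R) / 2).
pose em j l : 'cV[R]_k := \col_i (((i == j)%:R - (i == l)%:R) / 2).
pose gp j l : {ffun 'I_k -> 'I_m.*2.+1} :=
  [ffun i : 'I_k => inord (m + h * (i == j) + h * (i == l))].
pose gm j l : {ffun 'I_k -> 'I_m.*2.+1} :=
  [ffun i : 'I_k => inord (m + h * (i == j) - h * (i == l))].
have epE j l : ep j l = gridvec (gp j l).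
  apply/colP => i; rewrite !mxE ffunE inordK; last first.
    by rewrite ltnS -addnn {2}mh; case: (i == j); case: (i == l); lia.
  by rewrite !natrD !natrM hE; field; rewrite gt_eqF.
have emE j l : em j l = gridvec (gm j l).
  apply/colP => i; rewrite !mxE ffunE inordK; last first.
    by rewrite ltnS -addnn {2}mh; case: (i == j); case: (i == l); lia.
  rewrite natrB; last by rewrite mh; case: (i == j); case: (i == l); lia.
  by rewrite !natrD !natrM hE; field; rewrite gt_eqF.
have sq2 (b : bool) : b%:R ^+ 2 = b%:R :> R by case: b; rewrite ?expr1n ?expr0n.
have sumd (j : 'I_k) : \sum_(i < k) (i == j)%:R = 1 :> R.
  by rewrite (bigD1 j)//= eqxx big1 ?addr0// => i /negbTE ->.
have nrm (j l : 'I_k) (e : R) : e ^+ 2 = 1 ->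
    \sum_(i < k) (((i == j)%:R + e * (i == l)%:R) / 2) ^+ 2 <= 1.
  move=> e1; apply: (@le_trans _ _ (\sum_(i < k) ((i == j)%:R + (i == l)%:R) / 2)).
    apply: ler_sum => i _.
    have := sqr_ge0 ((i == j)%:R - e * (i == l)%:R : R).
    set a := (i == j)%:R; set b := (i == l)%:R.
    have -> : (a - e * b) ^+ 2 = a ^+ 2 - 2 * (a * (e * b)) + e ^+ 2 * b ^+ 2 by ring.
    have -> : ((a + e * b) / 2) ^+ 2 =
      (a ^+ 2 + 2 * (a * (e * b)) + e ^+ 2 * b ^+ 2) / 4 by field.
    rewrite e1 !sq2 -/a -/b; lra.
  by rewrite -mulr_suml big_split/= !sumd; lra.
have epn j l : sqnorm (ep j l) <= 1.
  have := nrm j l 1 (expr1n _ _); congr (_ <= _).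
  by apply: eq_bigr => i _; rewrite !mxE mul1r.
have emn j l : sqnorm (em j l) <= 1.
  have := nrm j l (-1) (etrans (sqrrN 1) (expr1n _ _)); congr (_ <= _).
  by apply: eq_bigr => i _; rewrite !mxE mulN1r.
have polar j l : qform A (ep j l) - qform A (em j l) = A j l.
  have dl (F : 'I_k -> R) (i : 'I_k) : \sum_a (a == i)%:R * F a = F i.
    by rewrite (bigD1 i)//= eqxx mul1r big1 ?addr0// => a /negbTE ->; rewrite mul0r.
  transitivity (\sum_a \sum_b (2^-1 * ((a == j)%:R * ((b == l)%:R * A a b)) +
      2^-1 * ((a == l)%:R * ((b == j)%:R * A a b)))).
    rewrite !qformE -sumrB; apply: eq_bigr => a _; rewrite -sumrB.
    by apply: eq_bigr => b _; rewrite !mxE; field.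
  under eq_bigr do rewrite big_split/= -!mulr_sumr !dl.
  rewrite big_split/= -!mulr_sumr !dl.
  have -> : A l j = A j l by rewrite -[in LHS]As mxE.
  by field.
have Aent j l : `|A j l| <= 2 * delta.
  rewrite -polar (le_trans (ler_normB _ _))// mulr_natl mulr2n lerD//.
    by rewrite epE; apply: Hgrid; rewrite -epE.
  by rewrite emE; apply: Hgrid; rewrite -emE.
have d0 : 0 <= 2 * delta by apply: le_trans (Aent (Ordinal k0) (Ordinal k0)).
have unit u : sqnorm u = 1 -> `|qform A u| <= 2 * delta.
  move=> u1.
  have [g [gn gA]] := grid_approx m0 u1.
  have qy := Hgrid g gn.
  suff : `|qform A u - qform A (gridvec g)| <= delta.
    have -> : qform A u = (qform A u - qform A (gridvec g)) + qform A (gridvec g) by ring.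
    rewrite addrK => h1; apply: (le_trans (ler_normD _ _)).
    by rewrite mulr_natl mulr2n lerD.
  apply: (le_trans (gA A)).
  have sumk (z : R) : \sum_(i < k) z = k%:R * z.
    by rewrite sumr_const card_ord mulr_natl.
  apply: (@le_trans _ _ (2 / m%:R * (k%:R * (k%:R * (2 * delta))))).
    rewrite ler_wpM2l ?divr_ge0//.
    apply: (@le_trans _ _ (\sum_(i < k) \sum_(j < k) 2 * delta)); last by rewrite !sumk.
    by apply: ler_sum => i _; apply: ler_sum => j _.
  rewrite mE le_eqVlt; apply/orP; left.
  by apply/eqP; field; rewrite gt_eqF.
move=> u; have [->|/normalize[v v1 [a a0 ->]]] := eqVneq u 0.
  by rewrite -(scale0r (0 : 'cV_k)) qformZ sqnormZ expr0n !mul0r mulr0 normr0.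
rewrite qformZ sqnormZ v1 mulr1 normrM mulrC (ger0_norm (sqr_ge0 a)).
by rewrite ler_wpM2r ?sqr_ge0// unit.
Qed.

End Grid.

Section Inversion.
Context {R : realType}.

Lemma pos_def_unit k (A : 'M[R]_k) : pos_def A -> A \in unitmx.
Proof.
move=> [_ Apos]; rewrite -row_free_unit -kermx_eq0; apply/rowV0P => v /sub_kermxP vA.
apply/eqP; apply: contraT => v0; have : v^T != 0 by rewrite trmx_eq0.
by move=> /Apos; rewrite trmxK vA mul0mx mxE ltxx.
Qed.

(** For [w = invmx A *m r] one has [a |w|^2 <= w^T r], and
    [w^T r <= (a / 2) |w|^2 + |r|^2 / (2 a)]. *)
Lemma l2norm_solve_le k (A : 'M[R]_k) (a tau : R) (r : 'cV[R]_k) :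
  pos_def A -> 0 < a -> (forall u, a * sqnorm u <= qform A u) -> 0 <= tau ->
  (forall j, `|r j 0| <= tau) ->
  l2norm (invmx A *m r) <= a^-1 * (Num.sqrt k%:R * tau).
Proof.
move=> Apos a0 Aa tau0 rtau; have Au := pos_def_unit Apos.
set w := invmx A *m r.
have Aw : A *m w = r by rewrite mulKVmx.
have qw : qform A w = \sum_i w i 0 * r i 0.
  by rewrite /qform -mulmxA Aw mxE; apply: eq_bigr => i _; rewrite mxE.
have qle : qform A w <= a / 2 * sqnorm w + (2 * a)^-1 * sqnorm r.
  rewrite qw !mulr_sumr -big_split/=; apply: ler_sum => i _.
  have := sqr_ge0 (a * w i 0 - r i 0); rewrite sqrrB exprMn.
  move=> h; rewrite -(ler_pM2l a0).
  have -> : a * (a / 2 * w i 0 ^+ 2 + (2 * a)^-1 * r i 0 ^+ 2) =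
    2^-1 * (a ^+ 2 * w i 0 ^+ 2 + r i 0 ^+ 2) by field; rewrite gt_eqF.
  lra.
have rn : sqnorm r <= k%:R * tau ^+ 2.
  rewrite mulr_natl -[X in _ *+ X](card_ord k) -sumr_const; apply: ler_sum => i _.
  by rewrite -real_normK ?num_real// ler_pXn2r ?nnegrE.
have wr : sqnorm w <= (a^-1 * (Num.sqrt k%:R * tau)) ^+ 2.
  have -> : (a^-1 * (Num.sqrt k%:R * tau)) ^+ 2 = k%:R * tau ^+ 2 / a ^+ 2.
    by rewrite !exprMn sqr_sqrtr// exprVn mulrC.
  rewrite ler_pdivlMr ?exprn_gt0// mulrC.
  apply: le_trans rn.
  have := le_trans (Aa w) qle => h.
  have := ler_wpM2l (ltW a0) h; rewrite mulrDr.
  have -> : a * ((2 * a)^-1 * sqnorm r) = sqnorm r / 2 by field; rewrite gt_eqF.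
  rewrite mulrA -expr2; lra.
rewrite l2normE -[leRHS]ger0_norm -?sqrtr_sqr ?ler_sqrt// ?sqr_ge0//.
by rewrite mulr_ge0 ?invr_ge0 ?(ltW a0)// mulr_ge0 ?sqrtr_ge0.
Qed.

End Inversion.

(** * Measurability of the estimation event *)

Section MeasurableEvent.
Context d (T : measurableType d) (R : realType).

Lemma random_mxM m n q (A : T -> 'M[R]_(m, n)) (B : T -> 'M[R]_(n, q)) :
  random_mx A -> random_mx B -> random_mx (fun w => A w *m B w).
Proof.
move=> mA mB i j; under eq_fun do rewrite mxE.
by apply: measurable_sum => l; apply: measurable_funM.
Qed.

Lemma measurable_det n (A : T -> 'M[R]_n) :
  random_mx A -> measurable_fun setT (fun w => \det (A w)).
Proof.
move=> mA; apply: measurable_sum => s; apply: measurable_funM => //.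
by apply: measurable_prod => i _; exact: mA.
Qed.

Lemma random_mx_adj n (A : T -> 'M[R]_n) :
  random_mx A -> random_mx (fun w => \adj (A w)).
Proof.
move=> mA i j; under eq_fun do rewrite mxE.
apply: measurable_funM => //; apply: measurable_det => a b.
by under eq_fun do rewrite !mxE; exact: mA.
Qed.

Lemma measurable_qform n (A : T -> 'M[R]_n) u :
  random_mx A -> measurable_fun setT (fun w => qform (A w) u).
Proof.
move=> mA; under eq_fun do rewrite qformE.
apply: measurable_sum => i; apply: measurable_sum => j.
by apply: measurable_funM => //; apply: measurable_funM => //; exact: mA.
Qed.

(** Semidefiniteness passes from the grids to all vectors by density, and a
    semidefinite invertible matrix is definite by [psd_unit_bounded]. *)
Lemma pos_def_grid k (A : 'M[R]_k) : A^T = A ->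
  pos_def A <-> \det A != 0 /\
    forall m (g : {ffun 'I_k -> 'I_m.*2.+1}), 0 <= qform A (gridvec g).
Proof.
move=> As; split=> [Apos|[Adet Agrid]].
  split; first by have := pos_def_unit Apos; rewrite unitmxE unitfE.
  move=> m g; have [->|u0] := eqVneq (gridvec g : 'cV[R]_k) 0.
    by rewrite -(scale0r (0 : 'cV_k)) qformZ expr0n mul0r.
  by apply: ltW; exact: Apos.2.
have A0 v : sqnorm v = 1 -> 0 <= qform A v.
  move=> v1; rewrite leNgt; apply/negP => qneg.
  pose C := \sum_i \sum_j `|A i j|.
  have C0 : 0 <= C by rewrite sumr_ge0// => i _; rewrite sumr_ge0.
  (* a mesh for which rounding [v] cannot change the sign of the form *)
  pose m := (Num.truncn (2 * C / - qform A v)).+1.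
  have q0 : 0 < - qform A v by rewrite oppr_gt0.
  have mR : 0 < m%:R :> R by rewrite ltr0n.
  have hm : 2 * C / - qform A v < m%:R by rewrite truncnS_gt.
  have [g [_ /(_ A)]] := @grid_approx R k m v isT v1.
  rewrite -/C => h.
  have {}h : - qform A v <= 2 / m%:R * C.
    apply: le_trans h; rewrite distrC; apply: le_trans (ler_norm _).
    by have := Agrid m g; lra.
  move: hm; rewrite ltr_pdivrMr// ltNge => /negP; apply.
  by move: h; rewrite mulrAC ler_pdivlMr// mulrC.
split=> // u u0; have Au : A \in unitmx by rewrite unitmxE unitfE.
have A0' v : 0 <= qform A v by have := qform_ge_scale A0 v; rewrite mul0r.
have [eps e0 He] := psd_unit_bounded As Au A0'.
rewrite -/(qform A u); apply: lt_le_trans (qform_ge_scale He u).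
by rewrite mulr_gt0 ?sqnorm_gt0.
Qed.

Lemma measurable_pos_def k (A : T -> 'M[R]_k) :
  random_mx A -> (forall w, (A w)^T = A w) -> measurable [set w | pos_def (A w)].
Proof.
move=> mA As.
have -> : [set w | pos_def (A w)] = (fun w => \det (A w)) @^-1` [set~ 0] `&`
    \bigcap_m \bigcap_(g : {ffun 'I_k -> 'I_m.*2.+1})
      (fun w => qform (A w) (gridvec g)) @^-1` `[0, +oo[.
  apply/seteqP; split => w /=.
    move=> /(pos_def_grid (As w))[d0 Ag]; split; first exact/eqP.
    by move=> m _ g _ /=; rewrite in_itv/= andbT.
  move=> [d0 Ag]; apply/(pos_def_grid (As w)); split; first exact/eqP.
  by move=> m g; have := Ag m I g I; rewrite /= in_itv/= andbT.
apply: measurableI.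
  rewrite -[X in measurable X]setTI; apply: measurable_det => //.
  by apply: measurableC.
apply: bigcap_measurableType => m _; apply: fin_bigcap_measurable => // g _.
by rewrite -[X in measurable X]setTI; apply: measurable_qform.
Qed.

(** On positive definite matrices, multiplying by the determinant turns the
    condition into a polynomial inequality between entries. *)
Lemma measurable_solve_close k (A : T -> 'M[R]_k) (g : T -> 'cV[R]_k) b c :
  random_mx A -> random_mx g -> (forall w, (A w)^T = A w) -> 0 <= c ->
  measurable [set w | pos_def (A w) /\ l2norm (invmx (A w) *m g w - b) <= c].
Proof.
move=> mA mg As c0.
pose f w := sqnorm (\adj (A w) *m g w - \det (A w) *: b).
have -> : [set w | pos_def (A w) /\ l2norm (invmx (A w) *m g w - b) <= c] =
    [set w | pos_def (A w)] `&`
    [set w | f w <= c ^+ 2 * \det (A w) ^+ 2].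
  apply/seteqP; split => w /= -[Apos]; have Au := pos_def_unit Apos;
    have dn : \det (A w) != 0 by [rewrite -unitfE -unitmxE|];
    (have -> : f w = \det (A w) ^+ 2 * sqnorm (invmx (A w) *m g w - b) by
      rewrite /f -sqnormZ scalerBr /invmx Au -scalemxAl scalerA mulfV ?scale1r);
    have d2 : 0 < \det (A w) ^+ 2 by [rewrite exprn_even_gt0|];
    rewrite mulrC ler_pM2r// l2normE => h; split=> //.
  - by rewrite -[leLHS]sqr_sqrtr ?sqnorm_ge0// ler_pXn2r ?nnegrE ?sqrtr_ge0.
  - by rewrite -[c]ger0_norm// -sqrtr_sqr ler_sqrt// sqr_ge0.
apply: measurableI; first exact: measurable_pos_def.
rewrite -[X in measurable X]setTI; apply: measurable_fun_le => //.
  apply: measurable_sum => i; apply: measurable_funX.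
  under eq_fun do rewrite !mxE; apply: measurable_funB.
    by apply: measurable_sum => j; apply: measurable_funM => //; exact: random_mx_adj.
  by apply: measurable_funM => //; exact: measurable_det.
by apply: measurable_funM => //; apply: measurable_funX; exact: measurable_det.
Qed.

End MeasurableEvent.

(** * Independence of the rows *)

Section RandomMatrixSigma.
Context d (T : measurableType d) (R : realType) (P : probability T R).
Context d' (S : measurableType d').

(** The generators in [sigma_mx V], in the form of an argument for
    [g_sigma_algebraType]. *)
Definition entry_sets m q (V : T -> 'M[S]_(m, q)) : set (set T) :=
  \bigcup_(ij : 'I_m * 'I_q)
    preimage_set_system setT (fun w => V w ij.1 ij.2) measurable.

Lemma entry_sets_sub m q (V : T -> 'M[S]_(m, q)) :
  random_mx V -> entry_sets V `<=` d.-measurable.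
Proof. by move=> mV A [[i j] _ [B mB <-]]; exact: mV. Qed.

Lemma sigma_mx_sub m q (V : T -> 'M[S]_(m, q)) :
  random_mx V -> sigma_mx V `<=` d.-measurable.
Proof. by move=> mV; apply: sigma_sub_measurable; exact: entry_sets_sub. Qed.

Lemma measurable_entry m q (V : T -> 'M[S]_(m, q)) i j :
  measurable_fun [set: g_sigma_algebraType (entry_sets V)] (fun w => V w i j).
Proof.
move=> _ Y mY; apply: sub_sigma_algebra; exists (i, j) => //=; exists Y => //.
Qed.

Lemma sigma_mxT m q (V : T -> 'M[S]_(m, q)) : sigma_mx V setT.
Proof. exact: (@measurableT _ (g_sigma_algebraType (entry_sets V))). Qed.

Lemma sigma_mxI m q (V : T -> 'M[S]_(m, q)) : setI_closed (sigma_mx V).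
Proof. by move=> A B; exact: (@measurableI _ (g_sigma_algebraType (entry_sets V))). Qed.

Lemma sigma_mx_bigcap m q (V : T -> 'M[S]_(m, q)) (I : finType) (J : set I) (A : I -> set T) :
  (forall i, J i -> sigma_mx V (A i)) -> sigma_mx V (\bigcap_(i in J) A i).
Proof.
move=> VA; have Jf : finite_set J by exact: finite_finset.
exact: (@fin_bigcap_measurable _ (g_sigma_algebraType (entry_sets V)) _ _ A).
Qed.

Lemma sigma_mx_mono m q m' q' d'' (S' : measurableType d'') (V : T -> 'M[S]_(m, q))
    (V' : T -> 'M[S']_(m', q')) :
  (forall i j, measurable_fun [set: g_sigma_algebraType (entry_sets V)] (fun w => V' w i j)) ->
  sigma_mx V' `<=` sigma_mx V.
Proof.
move=> VV'; apply: smallest_sub; first exact: smallest_sigma_algebra.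
by move=> A [[i j] _ [B mB <-]]; exact: VV'.
Qed.

End RandomMatrixSigma.

Section Rows.
Context d (T : measurableType d) (R : realType) (P : probability T R).
Context (n k : nat) (X : T -> 'M[R]_(n, k)) (e : T -> 'cV[R]_n) (D : T -> 'M[bool]_(n, k)).
Hypothesis mX : random_mx X.
Hypothesis me : random_mx e.
Hypothesis mD : random_mx D.
Hypothesis Xrows : mutually_independent P (fun i => sigma_mx (fun w => row i (X w))).
Hypothesis erows : mutually_independent P (fun i => sigma_mx (fun w => row i (e w))).
Hypothesis Dentries : mutually_independent P (fun ij : 'I_n * 'I_k =>
  preimage_set_system setT (fun w => D w ij.1 ij.2) measurable).
Hypothesis XE : independent P (sigma_mx X) (sigma_mx e).
Hypothesis DXE : independent P (sigma_mx D) (sigma_mx (fun w => row_mx (X w) (e w))).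

Definition mask_sets i j := preimage_set_system setT (fun w => D w i j) measurable.

(** A pi-system that generates the information carried by the row [i].  Its
    members are rectangles over the mask entries, the row of [X] and the row of
    [e], for which the hypotheses give the product rule at once. *)
Definition row_sets (i : 'I_n) : set (set T) :=
  [set A | exists (a : 'I_k -> set T) (B C : set T),
    [/\ forall j, mask_sets i j (a j), sigma_mx (fun w => row i (X w)) B,
        sigma_mx (fun w => row i (e w)) C & A = \bigcap_j a j `&` (B `&` C)]].

Let XE_w := fun w => row_mx (X w) (e w).

Lemma random_mx_row_mx : random_mx XE_w.
Proof.
move=> i j; rewrite -(splitK j); case: (fintype.split j) => l /=.
  by under eq_fun do rewrite /XE_w row_mxEl; exact: mX.
by under eq_fun do rewrite /XE_w row_mxEr; exact: me.
Qed.

Lemma sigma_row_X i : sigma_mx (fun w => row i (X w)) `<=` sigma_mx X.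
Proof.
apply: sigma_mx_mono => a b; under eq_fun do rewrite mxE; exact: measurable_entry.
Qed.

Lemma sigma_row_e i : sigma_mx (fun w => row i (e w)) `<=` sigma_mx e.
Proof.
apply: sigma_mx_mono => a b; under eq_fun do rewrite mxE; exact: measurable_entry.
Qed.

Lemma measurable_X_XE i j :
  measurable_fun [set: g_sigma_algebraType (entry_sets XE_w)] (fun w => X w i j).
Proof.
have := @measurable_entry d T _ _ _ _ XE_w i (lshift 1 j).
by under eq_fun do rewrite /XE_w row_mxEl.
Qed.

Lemma measurable_e_XE i j :
  measurable_fun [set: g_sigma_algebraType (entry_sets XE_w)] (fun w => e w i j).
Proof.
have := @measurable_entry d T _ _ _ _ XE_w i (rshift k j).
by under eq_fun do rewrite /XE_w row_mxEr.
Qed.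

Lemma sigma_X_XE : sigma_mx X `<=` sigma_mx XE_w.
Proof. by apply: sigma_mx_mono => i j; exact: measurable_X_XE. Qed.

Lemma sigma_e_XE : sigma_mx e `<=` sigma_mx XE_w.
Proof. by apply: sigma_mx_mono => i j; exact: measurable_e_XE. Qed.

Lemma mask_sets_sigma i j : mask_sets i j `<=` sigma_mx D.
Proof.
by move=> A [B mB <-]; exact: (@measurable_entry d T _ _ _ _ D i j measurableT B mB).
Qed.

Lemma mask_setsT i j : mask_sets i j setT.
Proof. by exists setT => //; rewrite preimage_setT setTI. Qed.

(** The mask is separated from [X] and [e], then [X] from [e], and finally each
    of the three families splits along its rows or entries. *)
Lemma rows_prob (J : {set 'I_n}) (a : 'I_n -> 'I_k -> set T) (B C : 'I_n -> set T) :
  (forall i j, mask_sets i j (a i j)) ->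
  (forall i, sigma_mx (fun w => row i (X w)) (B i)) ->
  (forall i, sigma_mx (fun w => row i (e w)) (C i)) ->
  P (\bigcap_(i in [set` J]) (\bigcap_j a i j `&` (B i `&` C i))) =
  (\prod_(i in J) (\prod_j P (a i j) * (P (B i) * P (C i))))%E.
Proof.
move=> Ha HB HC.
have -> : \bigcap_(i in [set` J]) (\bigcap_j a i j `&` (B i `&` C i)) =
    \bigcap_(ij in [set` finset.setX J (finset.setTfor 'I_k)]) a ij.1 ij.2 `&`
    (\bigcap_(i in [set` J]) B i `&` \bigcap_(i in [set` J]) C i).
  apply/seteqP; split => w /= H.
    split; [move=> [i j] /=|split=> i iJ]; last 2 first.
    - by have [_ []] := H i iJ.
    - by have [_ []] := H i iJ.
    by rewrite inE/= inE andbT => iJ; have [+ _] := H i iJ; exact.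
  move=> i iJ; have [Hw [Bw Cw]] := H; split; last by split; [exact: Bw|exact: Cw].
  by move=> j _; apply: (Hw (i, j)); rewrite /= inE/= inE andbT.
have BX : sigma_mx X (\bigcap_(i in [set` J]) B i).
  by apply: sigma_mx_bigcap => i _; exact: sigma_row_X (HB i).
have CE : sigma_mx e (\bigcap_(i in [set` J]) C i).
  by apply: sigma_mx_bigcap => i _; exact: sigma_row_e (HC i).
rewrite DXE; last 2 first.
- by apply: sigma_mx_bigcap => -[i j] _; exact: mask_sets_sigma (Ha i j).
- by apply: sigma_mxI; [exact: sigma_X_XE|exact: sigma_e_XE].
rewrite XE// Dentries; last by move=> [i j] _; exact: Ha.
rewrite Xrows; last by move=> i _; exact: HB.
rewrite erows; last by move=> i _; exact: HC.
rewrite !big_split/=; congr (_ * _)%E.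
by rewrite pair_big/=; apply: eq_bigl => -[i j]; rewrite !inE.
Qed.

(** The product rule of [rows_prob] is used for all rows and for a single row. *)
Lemma rows_independent : independent_pi_systems P row_sets.
Proof.
have row_meas i : row_sets i `<=` d.-measurable.
  move=> A [a [B [C [Ha HB HC ->]]]].
  apply: measurableI; last apply: measurableI.
  - apply: fin_bigcap_measurable => // j _.
    by apply: (sigma_mx_sub mD); exact: mask_sets_sigma (Ha j).
  - by apply: (sigma_mx_sub mX); exact: sigma_row_X HB.
  - by apply: (sigma_mx_sub me); exact: sigma_row_e HC.
split=> // [i|i|A /choice[a /choice[B /choice[C HA]]]].
- move=> A A' [a [B [C [Ha HB HC ->]]]] [a' [B' [C' [Ha' HB' HC' ->]]]].
  exists (fun j => a j `&` a' j), (B `&` B'), (C `&` C'); split.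
  + move=> j; have [Y mY <-] := Ha j; have [Y' mY' <-] := Ha' j.
    by exists (Y `&` Y'); [exact: measurableI|rewrite !setTI preimage_setI].
  + exact: sigma_mxI.
  + exact: sigma_mxI.
  + rewrite bigcapI; apply/seteqP; split => w /=; tauto.
- exists (fun=> setT), setT, setT; split; [exact: mask_setsT|exact: sigma_mxT|exact: sigma_mxT|].
  by apply/seteqP; split => w.
- have Ha i : forall j, mask_sets i j (a i j) by case: (HA i).
  have HB i : sigma_mx (fun w => row i (X w)) (B i) by case: (HA i).
  have HC i : sigma_mx (fun w => row i (e w)) (C i) by case: (HA i).
  have AE i : A i = \bigcap_j a i j `&` (B i `&` C i) by case: (HA i).
  transitivity (P (\bigcap_(i in [set` finset.setTfor 'I_n])
      (\bigcap_j a i j `&` (B i `&` C i)))).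
    congr (P _); apply/seteqP; split => w /= H i iT; first by rewrite -AE; exact: H.
    by rewrite AE; apply: H; rewrite /= inE.
  rewrite rows_prob// [RHS](eq_bigl (fun i => i \in finset.setTfor 'I_n)); last first.
    by move=> i; rewrite inE.
  apply: eq_bigr => i _.
  have := @rows_prob (finset.set1 i) _ _ _ Ha HB HC.
  rewrite big_set1 => <-; congr (P _); rewrite AE; apply/seteqP; split => w H.
    by apply: (H i); rewrite /= inE.
  by move=> l /=; rewrite inE => /eqP ->.
Qed.

End Rows.

(** * Union bounds and strict tails *)

Section UnionBounds.
Context d (T : measurableType d) (R : realType) (P : probability T R).

Lemma finite_union_bound (I : finType) (F : I -> set T) (b : R) :
  (forall i, measurable (F i)) -> (forall i, P (F i) <= b%:E)%E ->
  measurable [set w | exists i, F i w] /\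
  (P [set w | exists i, F i w] <= (#|I|%:R * b)%:E)%E.
Proof.
move=> mF Fb.
have mU : measurable [set w | exists i, F i w].
  rewrite (_ : [set w | _] = \bigcup_i F i).
    by apply: fin_bigcup_measurable => // i _; exact: mF.
  by apply/seteqP; split => w /= [i]; [exists i|move=> _; exists i].
split=> //.
have mS (s : seq I) : measurable (\big[setU/set0]_(i <- s) F i).
  by apply: bigsetU_measurable => i _; exact: mF.
have bound (s : seq I) : (P (\big[setU/set0]_(i <- s) F i) <= ((size s)%:R * b)%:E)%E.
  elim: s => [|i s IH]; first by rewrite big_nil measure0 mul0r.
  rewrite big_cons; apply: (le_trans (measureU2 _ (mF i) (mS s))).
  by rewrite /= -nat1r mulrDl mul1r EFinD leeD.
rewrite cardE; apply: le_trans (bound (enum I)).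
apply: le_measure; [exact: mem_set mU|exact: mem_set (mS _)|].
move=> w /= [i Fi]; rewrite -bigcup_seq; exists i => //=.
by rewrite mem_enum.
Qed.

(** Continuity of the measure from below.  It allows the scales [|beta|] and
    [sigma_e], which may vanish, to be approached by positive ones. *)
Lemma strict_tail_le (f : T -> R) (c b : R) : measurable_fun setT f ->
  (forall eps, 0 < eps -> (P [set w | (c + eps <= f w)%R] <= b%:E)%E) ->
  (P [set w | (c < f w)%R] <= b%:E)%E.
Proof.
move=> mf H; pose F m := [set w | c + m.+1%:R^-1 <= f w].
have mF m : measurable (F m).
  rewrite -[X in measurable X]setTI.
  exact: (measurable_fun_le (f := cst _)).
have -> : [set w | c < f w] = \bigcup_m F m.
  apply/seteqP; split => w /=; last first.
    by move=> [m _ /=]; apply: lt_le_trans; rewrite ltrDl invr_gt0.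
  move=> cf; exists (Num.truncn (f w - c)^-1) => //; rewrite /F /=.
  have d0 : 0 < f w - c by rewrite subr_gt0.
  rewrite -lerBrDl -[leRHS]invrK lef_pV2 ?posrE ?invr_gt0//.
  by apply: ltW; rewrite truncnS_gt.
have ndF : nondecreasing_seq F.
  move=> m n mn; apply/subsetPset => w; apply: le_trans.
  by rewrite lerD2l lef_pV2 ?posrE// ler_nat ltnS.
have mUF : measurable (\bigcup_m F m) by exact: bigcup_measurable.
have := nondecreasing_cvg_mu (mu := P) mF mUF ndF => cvgF.
rewrite -(cvg_lim _ cvgF)//; apply: lime_le; first by apply/cvg_ex; exists (P (\bigcup_m F m)).
by near=> m; apply: H; rewrite invr_gt0.
Unshelve. all: by end_near.
Qed.

End UnionBounds.

(** * Deviation levels and their probabilities *)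

Section Thresholds.
Context (R : realType) (n k p : nat) (a q lam : R).
Hypothesis n0 : (0 < n)%N.
Hypothesis k0 : (0 < k)%N.
Hypothesis p1 : (1 < p)%N.
Hypothesis a0 : 0 < a.
Hypothesis q1 : 1 <= q.
Hypothesis lam0 : 0 < lam.
Hypothesis lam_a : lam <= 2 * a.
Local Notation L := (ln p%:R : R).
Hypothesis nlarge :
  256 * 256 * a ^+ 2 * (q ^+ 2) ^+ 2 * (k%:R * L) <= n%:R * lam ^+ 2.

Let p0 : 0 < p%:R :> R. Proof. by rewrite ltr0n (ltn_trans _ p1). Qed.
Let L0 : 0 < L. Proof. by rewrite ln_gt0// ltr1n. Qed.
Let q0 : 0 < q. Proof. exact: lt_le_trans ltr01 q1. Qed.
Let q20 : 0 < q ^+ 2. Proof. by rewrite exprn_gt0. Qed.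
Let q21 : 1 <= q ^+ 2. Proof. by rewrite exprn_ege1. Qed.
Let n0R : 0 < n%:R :> R. Proof. by rewrite ltr0n. Qed.

Lemma expR_natM_ln m : expR (- (m%:R * L)) = (p%:R ^+ m)^-1.
Proof. by rewrite expRN expRM_natl lnK// posrE. Qed.

(** Level in [qform_concentration] at which the deviation is [lam / 4], with
    [q = (1 - rho)^-1] and [a = psi2_const]. *)
Definition form_level : R := lam / (8 * a * q ^+ 2).

Lemma form_level_range : 0 <= form_level <= 32.
Proof.
have d0 : 0 < 8 * a * q ^+ 2 by rewrite !mulr_gt0.
apply/andP; split; first by rewrite divr_ge0// ltW.
rewrite ler_pdivrMr//; have : a <= a * q ^+ 2 by rewrite ler_peMr// ltW.
have -> : 32 * (8 * a * q ^+ 2) = 256 * (a * q ^+ 2) by ring.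
by move: (a * q ^+ 2) => z h; move: a0 lam_a => ? ?; lra.
Qed.

Lemma form_levelE : form_level * (2 * a * q ^+ 2) = lam / 4.
Proof. by rewrite /form_level; field; rewrite !gt_eqF. Qed.

Lemma form_level_tail :
  2 * expR (- (n%:R * form_level ^+ 2 / 128)) <= 2 * (p%:R ^+ (8 * k))^-1.
Proof.
rewrite ler_pM2l// -expR_natM_ln ler_expR lerN2.
have -> : n%:R * form_level ^+ 2 / 128 =
    n%:R * lam ^+ 2 / (32 * 256 * (a ^+ 2 * (q ^+ 2) ^+ 2)).
  by rewrite /form_level; field; rewrite !gt_eqF.
have d0 : 0 < 32 * 256 * (a ^+ 2 * (q ^+ 2) ^+ 2) by rewrite !mulr_gt0 ?exprn_gt0.
rewrite ler_pdivlMr// natrM; apply: le_trans nlarge.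
by rewrite le_eqVlt; apply/orP; left; apply/eqP; ring.
Qed.

(** The factor [16] turns the tail of [residual_concentration] into
    [2 p^-2]. *)
Definition residual_level : R := 16 * Num.sqrt (L / n%:R).

Lemma residual_level_sqr : residual_level ^+ 2 = 256 * (L / n%:R).
Proof.
by rewrite exprMn sqr_sqrtr ?divr_ge0 ?(ltW L0) ?(ltW n0R)//; ring.
Qed.

Lemma residual_level_ge0 : 0 <= residual_level.
Proof. by rewrite mulr_ge0 ?sqrtr_ge0. Qed.

(** The sample size condition has [lam ^+ 2] on the right-hand side, and [lam] is
    at most [2 a]. *)
Lemma ln_le_sample_size : L <= n%:R.
Proof.
have a20 : 0 < a ^+ 2 by rewrite exprn_gt0.
have h1 : lam ^+ 2 <= (2 * a) ^+ 2.
  by rewrite ler_pXn2r// nnegrE ?mulr_ge0 ?(ltW lam0) ?(ltW a0).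
have h2 : n%:R * lam ^+ 2 <= n%:R * (2 * a) ^+ 2 by rewrite ler_wpM2l// ltW.
have h3 : 1 * L <= k%:R * L by rewrite ler_wpM2r ?(ltW L0)// ler1n.
have h4 : 1 * (k%:R * L) <= (q ^+ 2) ^+ 2 * (k%:R * L).
  by rewrite ler_wpM2r ?mulr_ge0 ?(ltW L0)// exprn_ege1.
have h5 : L <= (q ^+ 2) ^+ 2 * (k%:R * L).
  by move: h3 h4; rewrite !mul1r; exact: le_trans.
have c0 : 0 < 256 * 256 * a ^+ 2 by rewrite !mulr_gt0.
have h6 : 256 * 256 * a ^+ 2 * L <= n%:R * (2 * a) ^+ 2.
  apply: le_trans (le_trans nlarge h2).
  by rewrite -[leRHS]mulrA ler_wpM2l// ltW.
rewrite -(ler_pM2l c0); apply: (le_trans h6).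
rewrite (_ : n%:R * (2 * a) ^+ 2 = 4 * (a ^+ 2 * n%:R)); last by ring.
rewrite (_ : 256 * 256 * a ^+ 2 * n%:R = 256 * 256 * (a ^+ 2 * n%:R)); last by ring.
have : 0 < a ^+ 2 * n%:R by rewrite mulr_gt0.
by move: (_ * _) => z z0; lra.
Qed.

Lemma residual_level_range : 0 <= residual_level <= 32.
Proof.
rewrite residual_level_ge0/= -(@ler_pXn2r _ 2) ?nnegrE ?residual_level_ge0//.
rewrite residual_level_sqr.
have : L / n%:R <= 1 by rewrite ler_pdivrMr// mul1r ln_le_sample_size.
by move=> h; lra.
Qed.

Lemma residual_level_tail :
  2 * expR (- (n%:R * residual_level ^+ 2 / 128)) <= 2 * (p%:R ^+ 2)^-1.
Proof.
rewrite ler_pM2l// -expR_natM_ln ler_expR lerN2 residual_level_sqr le_eqVlt.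
by apply/orP; left; apply/eqP; field; rewrite gt_eqF.
Qed.

End Thresholds.

Section CardinalityBounds.
Context (R : realType) (k p : nat).
Hypothesis k0 : (0 < k)%N.
Hypothesis p1 : (1 < p)%N.
Hypothesis kp : (k <= p)%N.

Let p0 : 0 < p%:R :> R. Proof. by rewrite ltr0n (ltn_trans _ p1). Qed.

(** The number of grid points is at most [(9 p^2)^k <= p^(6 k)], because
    [9 <= 2 ^ 4 <= p ^ 4]. *)
Lemma grid_union_bound :
  #|{ffun 'I_k -> 'I_(4 * k ^ 2).*2.+1}|%:R * (2 * (p%:R ^+ (8 * k))^-1) <=
  2 * p%:R^-1 :> R.
Proof.
rewrite card_ffun !card_ord.
have c1 : ((4 * k ^ 2).*2.+1 <= p ^ 6)%N.
  have k2 : (k ^ 2 <= p ^ 2)%N by rewrite leq_exp2r.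
  have p4 : (2 ^ 4 <= p ^ 4)%N by rewrite leq_exp2r.
  have pp : (0 < p ^ 2)%N by rewrite expn_gt0 (ltn_trans _ p1).
  rewrite (_ : 6 = 4 + 2)%N// expnD.
  apply: (@leq_trans (2 ^ 4 * p ^ 2)); last by rewrite leq_mul2r p4 orbT.
  by move: (k ^ 2)%N (p ^ 2)%N k2 pp => x y; rewrite -muln2; lia.
have c2 : ((4 * k ^ 2).*2.+1 ^ k <= p ^ (6 * k))%N by rewrite expnM leq_exp2r.
apply: (@le_trans _ _ ((p ^ (6 * k))%:R * (2 * (p%:R ^+ (8 * k))^-1))).
  by rewrite ler_wpM2r ?ler_nat// mulr_ge0// invr_ge0 exprn_ge0// ltW.
rewrite natrX (_ : 8 * k = 6 * k + 2 * k)%N; last by rewrite -mulnDl.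
have cancel (x y : R) : x != 0 -> y != 0 -> x * (2 * (x * y)^-1) = 2 * y^-1.
  by move=> x0 y0; field; rewrite x0 y0.
rewrite exprD cancel ?expf_neq0 ?gt_eqF//.
rewrite ler_pM2l// lef_pV2 ?posrE ?exprn_gt0// -[leLHS]expr1 ler_weXn2l//.
  by rewrite ler1n (ltn_trans _ p1).
by rewrite muln_gt0.
Qed.

Lemma coordinates_union_bound : #|'I_k|%:R * (2 * (p%:R ^+ 2)^-1) <= 2 * p%:R^-1 :> R.
Proof.
rewrite card_ord; apply: (@le_trans _ _ (p%:R * (2 * (p%:R ^+ 2)^-1))).
  by rewrite ler_wpM2r ?ler_nat// mulr_ge0// invr_ge0 exprn_ge0// ltW.
by rewrite le_eqVlt; apply/orP; left; apply/eqP; field; rewrite gt_eqF.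
Qed.

End CardinalityBounds.

Lemma half_le_of_dist_le (R : realType) (x y s l : R) :
  l * s <= y -> - (2 * (l / 4) * s) <= x - y -> l / 2 * s <= x.
Proof. by move=> ? ?; lra. Qed.

(** * Regression with erased entries *)

Section Model.
Context d (T : measurableType d) (R : realType) (P : probability T R).
Context (n k : nat) (Sigma : 'M[R]_k) (sigma sigma_e rho : R).
Context (X : T -> 'M[R]_(n, k)) (e : T -> 'cV[R]_n) (D : T -> 'M[bool]_(n, k)).
Hypothesis n0 : (0 < n)%N.
Hypothesis k0 : (0 < k)%N.
Hypothesis rho0 : 0 <= rho.
Hypothesis rho1 : rho < 1.
Hypothesis HX : subgaussian_mx P X Sigma 1.
Hypothesis He : subgaussian_mx P e (sigma ^+ 2)%:M sigma_e.
Hypothesis XE : independent P (sigma_mx X) (sigma_mx e).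
Hypothesis HD : erasure_mask P rho D.
Hypothesis DXE : independent P (sigma_mx D) (sigma_mx (fun w => row_mx (X w) (e w))).

Let mX : random_mx X. Proof. by case: HX. Qed.
Let me : random_mx e. Proof. by case: He. Qed.
Let mD : random_mx D. Proof. by case: HD. Qed.

Let rn : R := (Num.sqrt n%:R)^-1.
Let rn0 : 0 < rn. Proof. by rewrite invr_gt0 sqrtr_gt0 ltr0n. Qed.
Let rn2 : rn * rn = n%:R^-1.
Proof. by rewrite -invfM -expr2 sqr_sqrtr. Qed.

Notation rowT i := (g_sigma_algebraType (row_sets X e D i)).

Lemma measurable_row_D i j : measurable_fun [set: rowT i] (fun w => D w i j).
Proof.
move=> _ Y mY; apply: sub_sigma_algebra.
exists (fun l => if l == j then (fun w => D w i j) @^-1` Y else setT), setT, setT.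
split; [|exact: sigma_mxT|exact: sigma_mxT|].
  move=> l; case: eqP => [->|_]; last exact: mask_setsT.
  by exists Y => //; rewrite setTI.
rewrite !setTI setIT; apply/seteqP; split => w /= H.
  by move=> l _; case: eqP.
by have := H j I; rewrite eqxx.
Qed.

Lemma measurable_row_X i j : measurable_fun [set: rowT i] (fun w => X w i j).
Proof.
move=> _ Y mY; apply: sub_sigma_algebra.
exists (fun=> setT), ((fun w => X w i j) @^-1` Y), setT.
split; [by move=> ?; exact: mask_setsT| |exact: sigma_mxT|].
  have E : (fun w => row i (X w) 0 j) = (fun w => X w i j).
    by apply/funext => w; rewrite mxE.
  have := @measurable_entry d T _ R _ _ (fun w => row i (X w)) 0 j measurableT Y mY.
  by rewrite setTI E.
by rewrite setIT bigcap_const//; exists j.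
Qed.

Lemma measurable_row_e i : measurable_fun [set: rowT i] (fun w => e w i 0).
Proof.
move=> _ Y mY; apply: sub_sigma_algebra.
exists (fun=> setT), setT, ((fun w => e w i 0) @^-1` Y).
split; [by move=> ?; exact: mask_setsT|exact: sigma_mxT| |].
  have E : (fun w => row i (e w) 0 0) = (fun w => e w i 0).
    by apply/funext => w; rewrite mxE.
  have := @measurable_entry d T _ R _ _ (fun w => row i (e w)) 0 0 measurableT Y mY.
  by rewrite setTI E.
by rewrite [setT `&` (_ @^-1` Y)]setTI; apply/seteqP; split => w //= -[].
Qed.

(** The factor by which masking multiplies an entry. *)
Definition keep (b : bool) : R := (~~ b)%:R.

Lemma measurable_keep d' (S : measurableType d') (b : S -> bool) :
  measurable_fun setT b -> measurable_fun setT (fun w => keep (b w)).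
Proof. by move=> mb; apply: measurableT_comp. Qed.

Local Notation Z := (fun w => erase (D w) (X w)).

Lemma eraseE w i j : erase (D w) (X w) i j = keep (D w i j) * X w i j.
Proof. by rewrite mxE /keep; case: (D w i j); rewrite ?mul0r ?mul1r. Qed.

Lemma measurable_row_Z i j : measurable_fun [set: rowT i] (fun w => Z w i j).
Proof.
under eq_fun do rewrite eraseE; apply: measurable_funM.
  exact: measurable_keep (@measurable_row_D i j).
exact: measurable_row_X.
Qed.

Lemma has_mean_bool (b : T -> bool) p : measurable_fun setT b ->
  P [set w | b w] = p%:E -> has_mean P (fun w => (b w)%:R) p.
Proof.
move=> mb Pb; have mB : measurable [set w | b w].
  by rewrite -[X in measurable X]setTI; exact: mb.
have -> : (fun w => (b w)%:R) = \1_[set w | b w] :> (T -> R).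
  by apply/funext => w; rewrite indicE mem_setE.
apply: ge0_has_mean; [exact: measurable_indic|by move=> w; rewrite indicE|].
by rewrite expectation_indic.
Qed.

Lemma prob_kept i j : P [set w | ~~ D w i j] = (1 - rho)%:E.
Proof.
have [_ Drho _] := HD.
have mB : measurable [set w | D w i j].
  by rewrite -[X in measurable X]setTI; exact: mD.
have -> : [set w | ~~ D w i j] = ~` [set w | D w i j].
  by apply/seteqP; split => w /= /negP.
by rewrite probability_setC// Drho.
Qed.

Lemma has_mean_keep i j : has_mean P (fun w => keep (D w i j)) (1 - rho).
Proof.
apply: has_mean_bool; last exact: prob_kept.
by apply: measurableT_comp; [|exact: mD].
Qed.

Lemma has_mean_keep2 i j l : j != l ->
  has_mean P (fun w => keep (D w i j) * keep (D w i l)) ((1 - rho) ^+ 2).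
Proof.
move=> jl; have [_ _ Dind] := HD.
have -> : (fun w => keep (D w i j) * keep (D w i l)) =
    (fun w => (~~ D w i j && ~~ D w i l)%:R).
  by apply/funext => w; rewrite /keep -natrM mulnb.
apply: has_mean_bool.
  by apply: measurable_and; apply: measurable_neg; exact: mD.
have := Dind (finset.setU (finset.set1 (i, j)) (finset.set1 (i, l)))
  (fun ij => [set w | ~~ D w ij.1 ij.2]).
rewrite big_setU1/= ?big_set1 ?inE ?xpair_eqE ?(negbTE jl) ?andbF//= !prob_kept.
rewrite expr2 EFinM => <-; last first.
  move=> [a b] _ /=; exists [set false] => //; rewrite setTI.
  by apply/seteqP; split => w /=; [move=> ->|move/negbTE].
congr (P _); apply/seteqP; split => w /=.
  by move=> /andP[wj wl] [a b] /=; rewrite !inE => /orP[]/eqP[-> ->].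
by move=> H; apply/andP; split; [apply: (H (i, j))|apply: (H (i, l))]; rewrite /= !inE eqxx ?orbT.
Qed.

(** A sub-Gaussian matrix controls unit vectors only; the zero vector, which has
    no direction, is written as [0] times a basis vector. *)
Lemma psi2_X i (v : 'cV[R]_k) b : 0 < b -> sqnorm v <= b ^+ 2 ->
  psi2 P (fun w => \sum_l X w i l * v l 0) (b * rn).
Proof.
move=> b0 vb; have [_ _ _ _ HXu] := HX.
have unit u : sqnorm u = 1 -> psi2 P (fun w => \sum_l X w i l * u l 0) rn.
  move=> u1; have [|s [s0 srn sub]] := HXu i u; first by rewrite l2normE u1 sqrtr1.
  rewrite mulr1 in srn; have := subgaussian_psi2 sub s0 srn rn0.
  by under eq_fun do (rewrite mxE; under eq_bigr do rewrite mxE).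
have scale a u : sqnorm u = 1 -> `|a| <= b ->
    psi2 P (fun w => \sum_l X w i l * (a *: u) l 0) (b * rn).
  move=> u1 ab; have := psi2Z (c := a) (unit u u1) rn0 (mulr_gt0 b0 rn0).
  rewrite ler_wpM2r ?(ltW rn0)// => /(_ isT).
  congr (psi2 P _ _); apply/funext => w; rewrite mulr_sumr.
  by apply: eq_bigr => l _; rewrite mxE; ring.
have [->|/normalize[u u1 [a a0 vE]]] := eqVneq v 0.
  rewrite -(scale0r (delta_mx (Ordinal k0) 0)); apply: scale; first exact: sqnorm_delta.
  by rewrite normr0 ltW.
rewrite vE; apply: scale => //; rewrite gtr0_norm//.
rewrite -(@ler_pXn2r _ 2)// ?nnegrE ?(ltW a0) ?(ltW b0)//.
by apply: le_trans vb; rewrite vE sqnormZ u1 mulr1.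
Qed.

Lemma psi2_e i s : 0 < s -> sigma_e <= s -> psi2 P (fun w => e w i 0) (s * rn).
Proof.
move=> s0 ses; have [_ _ _ _ Heu] := He.
have [|t [t0 trn sub]] := Heu i (const_mx 1).
  by rewrite /l2norm big_ord1 mxE expr1n sqrtr1.
have := subgaussian_psi2 sub t0 (le_trans trn _) (mulr_gt0 s0 rn0).
rewrite mulrC ler_wpM2r ?(ltW rn0)// => /(_ isT).
by under eq_fun do rewrite !mxE big_ord1 !mxE mulr1.
Qed.


Let mXE : random_mx (fun w => row_mx (X w) (e w)).
Proof. exact: random_mx_row_mx. Qed.

Lemma has_meanM_D (f g : T -> R) a b :
  measurable_fun [set: g_sigma_algebraType (entry_sets D)] f ->
  measurable_fun [set: g_sigma_algebraType (entry_sets (fun w => row_mx (X w) (e w)))] g ->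
  has_mean P f a -> has_mean P g b -> has_mean P (fun w => f w * g w) (a * b).
Proof.
by apply: has_meanM_independent; [exact: entry_sets_sub|exact: entry_sets_sub|exact: DXE].
Qed.

Lemma measurable_keep_D i j :
  measurable_fun [set: g_sigma_algebraType (entry_sets D)] (fun w => keep (D w i j)).
Proof. by apply: measurable_keep; exact: measurable_entry. Qed.

(** Decompose according to the value [p] of the mask of the row.  Given [p], the
    combination is that of the row of [X] with the vector [vp p], obtained from
    [v] by erasing coordinates; by independence the bound for [X] is averaged
    with the probabilities of the masks. *)
Lemma psi2_Z i (v : 'cV[R]_k) b : 0 < b -> sqnorm v <= b ^+ 2 ->
  psi2 P (fun w => \sum_l Z w i l * v l 0) (b * rn).
Proof.
move=> b0 vb.
have mZ : measurable_fun setT (fun w => \sum_l Z w i l * v l 0).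
  apply: measurable_sum => l; apply: measurable_funM => //.
  under eq_fun do rewrite eraseE; apply: measurable_funM; last exact: mX.
  by apply: measurable_keep; exact: mD.
split=> //.
(* indicator of the event that the mask of the row is [p] *)
pose I (p : {ffun 'I_k -> bool}) w : R := \prod_j (D w i j == p j)%:R.
pose vp (p : {ffun 'I_k -> bool}) : 'cV[R]_k := \col_l (if p l then 0 else v l 0).
pose q p w := expR ((\sum_l X w i l * vp p l 0) ^+ 2 / (psi2_const R * (b * rn) ^+ 2)).
have IE w (F : {ffun 'I_k -> bool} -> R) : \sum_p I p w * F p = F [ffun j => D w i j].
  rewrite (bigD1 [ffun j => D w i j])//= big1 => [|p pn].
    by rewrite addr0 /I big1 ?mul1r// => j _; rewrite ffunE eqxx.
  have /existsP[j jn] : [exists j, p j != D w i j].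
    rewrite -negb_forall; apply: contra pn => /forallP h.
    by apply/eqP/ffunP => j; rewrite ffunE; exact/eqP.
  by rewrite /I (bigD1 j)//= eq_sym (negbTE jn) !mul0r.
have mI p d' (S : measurableType d') (b' : 'I_k -> S -> bool) :
    (forall j, measurable_fun setT (b' j)) ->
    measurable_fun setT (fun w => \prod_j (b' j w == p j)%:R : R).
  move=> mb; apply: measurable_prod => j _.
  by apply: (measurableT_comp (f := fun x : bool => (x == p j)%:R : R)) => //; exact: mb.
have I0 p w : 0 <= I p w by rewrite prodr_ge0.
have I1 p w : I p w <= 1.
  by apply: prodr_ile1 => j _; rewrite ler0n lern1 leq_b1.
have mIT p : measurable_fun [set: T] (I p).
  by apply: (mI p d T (fun j w => D w i j)) => j; exact: mD.
have mID p : measurable_fun [set: g_sigma_algebraType (entry_sets D)] (I p).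
  by apply: (mI p _ (g_sigma_algebraType (entry_sets D)) (fun j w => D w i j)) => j;
    exact: measurable_entry.
have /choice[pr Hpr] : forall p, exists a, has_mean P (I p) a.
  move=> p; apply: (@has_mean_bounded _ _ _ _ _ (cst 1)) => //.
    by move=> w; rewrite ger0_norm.
  by rewrite (expectation_cst P 1) ltry.
have pr0 p : 0 <= pr p by rewrite -lee_fin -(Hpr p).2 expectation_ge0.
have pr1 : \sum_p pr p = 1.
  have := has_mean_sum (index_enum _) Hpr; move=> /has_mean_unique; apply.
  have -> : (fun w => \sum_p I p w) = cst 1.
    by apply/funext => w; have := IE w (fun=> 1); under eq_bigr do rewrite mulr1.
  apply: ge0_has_mean => //; exact: (expectation_cst P 1).
have qpsi p : ('E_P[q p] <= 2%:E)%E.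
  have [|//] := @psi2_X i (vp p) b b0; apply: le_trans vb; apply: ler_sum => l _.
  by rewrite mxE; case: (p l); rewrite ?expr0n ?sqr_ge0.
have mq p d' (S : measurableType d') (x : 'I_k -> S -> R) :
    (forall j, measurable_fun setT (x j)) -> measurable_fun setT
      (fun w => expR ((\sum_l x l w * vp p l 0) ^+ 2 / (psi2_const R * (b * rn) ^+ 2))).
  move=> mx; apply: measurableT_comp; first exact: measurable_expR.
  apply: measurable_funM => //; apply: measurable_funX; apply: measurable_sum => l.
  exact: measurable_funM.
have mqT p : measurable_fun [set: T] (q p).
  by apply: (mq p d T (fun j w => X w i j)) => j; exact: mX.
have mqXE p : measurable_fun
    [set: g_sigma_algebraType (entry_sets (fun w => row_mx (X w) (e w)))] (q p).
  apply: (mq p _ (g_sigma_algebraType (entry_sets (fun w => row_mx (X w) (e w))))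
    (fun j w => X w i j)) => j; exact: measurable_X_XE.
have q0 p w : 0 <= q p w by exact: expR_ge0.
have -> : (fun w => expR ((\sum_l Z w i l * v l 0) ^+ 2 / (psi2_const R * (b * rn) ^+ 2))) =
    (fun w => \sum_p I p w * q p w).
  apply/funext => w; rewrite IE /q.
  have -> : \sum_l Z w i l * v l 0 =
      \sum_l X w i l * vp [ffun j => D w i j] l 0.
    apply: eq_bigr => l _.
    by rewrite !mxE ffunE; case: (D w i l); rewrite ?mul0r ?mulr0.
  by [].
rewrite ge0_expectation_sum; last 2 first.
- by move=> p; exact: measurable_funM.
- by move=> p w; rewrite mulr_ge0.
apply: (@le_trans _ _ (\sum_p (pr p * 2)%:E)%E); last first.
  by rewrite sumEFin -mulr_suml pr1 mul1r.
apply: lee_sum => p _.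
rewrite (ge0_expectationM_independent (entry_sets_sub mD) (entry_sets_sub mXE) DXE
  (mID p) (mqXE p) (I0 p) (q0 p) (Hpr p).2).
by rewrite [leRHS]EFinM lee_wpmul2l ?lee_fin.
Qed.

Lemma psi2_Z_entry i j : psi2 P (fun w => Z w i j) rn.
Proof.
have := @psi2_Z i (delta_mx j 0) 1 ltr01.
rewrite sqnorm_delta expr1n lexx mul1r => /(_ isT); congr (psi2 P _ _); apply/funext => w.
rewrite (bigD1 j)//= big1 ?mxE ?eqxx ?mulr1 ?addr0// => l lj.
by rewrite !mxE (negbTE lj) mulr0.
Qed.

Lemma psi2_X_entry i j : psi2 P (fun w => X w i j) rn.
Proof.
have := @psi2_X i (delta_mx j 0) 1 ltr01.
rewrite sqnorm_delta expr1n lexx mul1r => /(_ isT); congr (psi2 P _ _); apply/funext => w.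
rewrite (bigD1 j)//= big1 ?mxE ?eqxx ?mulr1 ?addr0// => l lj.
by rewrite !mxE (negbTE lj) mulr0.
Qed.

(** The product is integrable by [psi1_mul], which the value of the expectation
    alone would not say. *)
Lemma has_mean_XX i j l :
  has_mean P (fun w => X w i j * X w i l) (n%:R^-1 * Sigma j l).
Proof.
have p1 := psi1_mul (psi2_X_entry i j) (psi2_X_entry i l) rn0 rn0.
have [|m Hm] := psi1_has_mean _ p1; first by rewrite mulr_gt0 ?psi2_const_gt0 ?mulr_gt0.
by have [_ _ _ HS _] := HX; split; [exact: Hm.1|exact: HS].
Qed.

Lemma Sigma_sym : Sigma^T = Sigma.
Proof.
apply/matrixP => j l; rewrite mxE; pose i : 'I_n := Ordinal n0.
have := has_mean_XX i j l; have := has_mean_XX i l j.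
have -> : (fun w => X w i l * X w i j) = (fun w => X w i j * X w i l).
  by apply/funext => w; rewrite mulrC.
move=> h1 h2; have /mulfI := has_mean_unique h1 h2; apply.
by rewrite invr_eq0 pnatr_eq0 -lt0n.
Qed.

Lemma has_mean_e i : has_mean P (fun w => e w i 0) 0.
Proof.
have [_ He0 _ _ _] := He.
have s0 : 0 < `|sigma_e| + 1 by rewrite ltr_pwDr.
have p2 : psi2 P (fun w => e w i 0) ((`|sigma_e| + 1) * rn).
  by apply: psi2_e => //; rewrite (le_trans (ler_norm _))// lerDl.
have [|m Hm] := psi2_has_mean _ p2; first by rewrite mulr_gt0.
by split; [exact: Hm.1|exact: He0].
Qed.

Lemma has_mean_X i j : has_mean P (fun w => X w i j) 0.
Proof.
have [_ HX0 _ _ _] := HX.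
have [m Hm] := psi2_has_mean rn0 (psi2_X_entry i j).
by split; [exact: Hm.1|exact: HX0].
Qed.

Lemma has_mean_Xe i j : has_mean P (fun w => X w i j * e w i 0) 0.
Proof.
rewrite -(mulr0 0); apply: (has_meanM_independent (entry_sets_sub mX)
  (entry_sets_sub me) XE _ _ (has_mean_X i j) (has_mean_e i)).
  exact: measurable_entry.
exact: measurable_entry.
Qed.

Lemma has_mean_Ze i j : has_mean P (fun w => Z w i j * e w i 0) 0.
Proof.
have mg : measurable_fun
    [set: g_sigma_algebraType (entry_sets (fun w => row_mx (X w) (e w)))]
    (fun w => X w i j * e w i 0).
  by apply: measurable_funM; [exact: measurable_X_XE|exact: measurable_e_XE].
have := has_meanM_D (@measurable_keep_D i j) mg (has_mean_keep i j) (has_mean_Xe i j).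
rewrite mulr0; congr (has_mean P _ _); apply/funext => w; rewrite eraseE; ring.
Qed.

Lemma measurable_XX_XE i j l :
  measurable_fun [set: g_sigma_algebraType (entry_sets (fun w => row_mx (X w) (e w)))]
    (fun w => X w i j * X w i l).
Proof. by apply: measurable_funM; exact: measurable_X_XE. Qed.

Lemma has_mean_ZX i j l :
  has_mean P (fun w => Z w i j * X w i l) ((1 - rho) * (n%:R^-1 * Sigma j l)).
Proof.
have := has_meanM_D (@measurable_keep_D i j) (@measurable_XX_XE i j l)
  (has_mean_keep i j) (has_mean_XX i j l).
congr (has_mean P _ _); apply/funext => w; rewrite eraseE; ring.
Qed.

Lemma has_mean_ZZ i j l : has_mean P
  (fun w => correction_mx k rho j l * (Z w i j * Z w i l)) (n%:R^-1 * Sigma j l).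
Proof.
have r0 : 1 - rho != 0 by rewrite subr_eq0 eq_sym lt_eqF.
rewrite /correction_mx mxE; case: eqVneq => [<-|jl].
  have := has_meanZ (1 - rho)^-1 (has_meanM_D (@measurable_keep_D i j)
    (@measurable_XX_XE i j j) (has_mean_keep i j) (has_mean_XX i j j)).
  rewrite mulrA mulVf// mul1r; congr (has_mean P _ _); apply/funext => w.
  rewrite eraseE /keep; case: (D w i j) => /=; ring.
have mk : measurable_fun [set: g_sigma_algebraType (entry_sets D)]
    (fun w => keep (D w i j) * keep (D w i l)).
  by apply: measurable_funM; exact: measurable_keep_D.
have := has_meanZ ((1 - rho) ^+ 2)^-1 (has_meanM_D mk
  (@measurable_XX_XE i j l) (has_mean_keep2 i jl) (has_mean_XX i j l)).
rewrite mulrA mulVf ?expf_neq0// mul1r; congr (has_mean P _ _); apply/funext => w.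
rewrite !eraseE; ring.
Qed.

Local Notation M := (correction_mx k rho).
Let q : R := (1 - rho)^-1.

Let q1 : 1 <= q.
Proof. by rewrite /q -[leLHS]invr1 lef_pV2 ?posrE ?subr_gt0// gerBl. Qed.

(** The correction is [q^2 (J - rho I)] with [J] the all-ones matrix. *)
Lemma correction_mxE j l : M j l = q ^+ 2 * (1 - rho * (j == l)%:R).
Proof.
rewrite mxE /q; case: eqP => _; last by rewrite mulr0 subr0 mulr1 exprVn.
by rewrite mulr1; field; rewrite subr_eq0 eq_sym lt_eqF.
Qed.

Let rows_ind : independent_pi_systems P (row_sets X e D).
Proof.
by apply: rows_independent => //; [case: HX|case: He|case: HD].
Qed.

(** Contribution of the row [i] to the quadratic form of [Sigma_hat]. *)
Definition row_qform (u : 'cV[R]_k) (i : 'I_n) (w : T) : R :=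
  \sum_j \sum_l u j 0 * (M j l * (Z w i j * Z w i l)) * u l 0.

Lemma qform_Sigma_hat u w : qform (Sigma_hat rho (Z w)) u = \sum_i row_qform u i w.
Proof.
rewrite qformE /row_qform [RHS]exchange_big; apply: eq_bigr => j _.
rewrite [RHS]exchange_big; apply: eq_bigr => l _.
rewrite -mulr_suml -mulr_sumr -mulr_sumr; congr (_ * _ * _).
rewrite mxE [(_ *m _) _ _]mxE mulrC; congr (_ * _).
by apply: eq_bigr => i _; rewrite mxE.
Qed.

(** This form has two terms to estimate instead of [k^2]. *)
Lemma row_qformE u i w : row_qform u i w =
  q ^+ 2 * ((\sum_l Z w i l * u l 0) * (\sum_l Z w i l * u l 0)) +
  - (q ^+ 2 * rho) * \sum_j u j 0 ^+ 2 * (Z w i j * Z w i j).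
Proof.
rewrite /row_qform mulr_suml !mulr_sumr -big_split/=; apply: eq_bigr => j _.
under eq_bigr do rewrite correction_mxE.
rewrite (bigD1 j)//= eqxx mulr1 [X in _ = _ * (_ * X) + _](bigD1 j)//=.
have -> : \sum_(l < k | l != j) u j 0 * (q ^+ 2 * (1 - rho * (j == l)%:R) *
    (Z w i j * Z w i l)) * u l 0 =
    q ^+ 2 * (Z w i j * u j 0 * \sum_(l < k | l != j) Z w i l * u l 0).
  rewrite !mulr_sumr; apply: eq_bigr => l lj.
  by rewrite eq_sym (negbTE lj) mulr0; ring.
ring.
Qed.

Lemma measurable_row_qform u i : measurable_fun [set: rowT i] (row_qform u i).
Proof.
apply: measurable_sum => j; apply: measurable_sum => l.
apply: measurable_funM => //; apply: measurable_funM => //.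
by apply: measurable_funM => //; apply: measurable_funM; exact: measurable_row_Z.
Qed.

Lemma has_mean_row_qform u i : has_mean P (row_qform u i) (n%:R^-1 * qform Sigma u).
Proof.
rewrite qformE mulr_sumr; apply: has_mean_sum => j.
rewrite mulr_sumr; apply: has_mean_sum => l.
have := has_meanZ (u j 0 * u l 0) (has_mean_ZZ i j l).
have -> : n%:R^-1 * (u j 0 * Sigma j l * u l 0) =
  u j 0 * u l 0 * (n%:R^-1 * Sigma j l) by ring.
congr (has_mean P _ _); apply/funext => w; ring.
Qed.

Let a0 := psi2_const_gt0 R.
Let nR0 : 0 < n%:R :> R. Proof. by rewrite ltr0n. Qed.
Let an0 : 0 < psi2_const R * (rn * rn).
Proof. by rewrite !mulr_gt0. Qed.
Let q0 : 0 < q. Proof. exact: lt_le_trans q1. Qed.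

Lemma psi1_row_qform u i : sqnorm u <= 1 ->
  psi1 P (row_qform u i) (2 * psi2_const R * q ^+ 2 / n%:R).
Proof.
move=> u1; rewrite (funext (row_qformE u i)).
have -> : 2 * psi2_const R * q ^+ 2 / n%:R =
    q ^+ 2 * (psi2_const R * (rn * rn)) + q ^+ 2 * (psi2_const R * (rn * rn)).
  by rewrite rn2; ring.
have q20 : 0 < q ^+ 2 by rewrite exprn_gt0.
have t0 : 0 < q ^+ 2 * (psi2_const R * (rn * rn)) by rewrite mulr_gt0.
apply: psi1D => //.
  have u1' : sqnorm u <= 1 ^+ 2 by rewrite expr1n.
  have p2 := @psi2_Z i u 1 ltr01 u1'; rewrite mul1r in p2.
  apply: (psi1Z (psi1_mul p2 p2 rn0 rn0)) => //.
  by rewrite ger0_norm// ltW.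
have p1 : psi1 P (fun w => \sum_j u j 0 ^+ 2 * (Z w i j * Z w i j)) (psi2_const R * (rn * rn)).
  apply: (@psi1_lincomb _ _ _ _ _ _ _ (fun=> psi2_const R * (rn * rn))) => //.
    by move=> j; apply: psi1_mul; rewrite ?rn0//; exact: psi2_Z_entry.
  rewrite -mulr_suml ler_piMl ?(ltW an0)// (le_trans _ u1)// /sqnorm.
  by apply: ler_sum => j _; rewrite ger0_norm ?sqr_ge0.
apply: (psi1Z p1) => //.
rewrite normrN normrM ger0_norm ?(ltW q20)// ger0_norm//.
by rewrite ler_wpM2r ?(ltW an0)// ler_piMr ?(ltW q20)// ltW.
Qed.

Lemma qform_concentration u t : sqnorm u <= 1 -> 0 <= t <= 32 ->
  (P [set w | (t * (2 * psi2_const R * q ^+ 2) <=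
      `|qform (Sigma_hat rho (Z w) - Sigma) u|)%R] <=
   (2 * expR (- (n%:R * t ^+ 2 / 128)))%:E)%E.
Proof.
move=> u1 t32; have th0 : 0 < 2 * psi2_const R * q ^+ 2 by rewrite !mulr_gt0 ?exprn_gt0.
have := bernstein rows_ind n0 th0 t32 (measurable_row_qform u)
  (fun i => psi1_row_qform i u1) (has_mean_row_qform u).
have -> : \sum_(i < n) n%:R^-1 * qform Sigma u = qform Sigma u.
  by rewrite sumr_const card_ord -[LHS]mulr_natl mulrA mulfV ?mul1r// gt_eqF.
congr (P _ <= _)%E; apply/seteqP; split => w /=; by rewrite qformB qform_Sigma_hat.
Qed.

(** Contribution of the row [i] to the coordinate [j] of
    [gamma_hat - Sigma_hat *m beta]. *)
Definition row_residual (beta : 'cV[R]_k) (j : 'I_k) (i : 'I_n) (w : T) : R :=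
  q * (Z w i j * (\sum_l X w i l * beta l 0)) + q * (Z w i j * e w i 0) -
  \sum_l (M j l * (Z w i j * Z w i l)) * beta l 0.

Lemma residualE beta j w :
  (gamma_hat rho (Z w) (X w *m beta + e w) - Sigma_hat rho (Z w) *m beta) j 0 =
  \sum_i row_residual beta j i w.
Proof.
have -> : (gamma_hat rho (Z w) (X w *m beta + e w) - Sigma_hat rho (Z w) *m beta) j 0 =
    q * ((Z w)^T *m (X w *m beta + e w)) j 0 - (Sigma_hat rho (Z w) *m beta) j 0.
  by rewrite !mxE.
rewrite /row_residual !big_split/= sumrN; congr (_ - _).
  rewrite -!mulr_sumr -mulrDr -big_split/= mxE; congr (_ * _); apply: eq_bigr => i _.
  by rewrite -mulrDr; congr (_ * _); rewrite !mxE.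
rewrite exchange_big mxE; apply: eq_bigr => l _.
rewrite -mulr_suml -mulr_sumr; congr (_ * _).
rewrite mxE [(_ *m _) _ _]mxE mulrC; congr (_ * _).
by apply: eq_bigr => i _; rewrite mxE.
Qed.

Lemma row_residualE beta j i w : row_residual beta j i w =
  (q * (Z w i j * (\sum_l X w i l * beta l 0)) + q * (Z w i j * e w i 0)) +
  (- q ^+ 2 * (Z w i j * (\sum_l Z w i l * beta l 0)) +
   q ^+ 2 * rho * beta j 0 * (Z w i j * Z w i j)).
Proof.
rewrite /row_residual; congr (_ + _).
under eq_bigr do rewrite correction_mxE.
rewrite (bigD1 j)//= eqxx mulr1 [X in _ = _ * (_ * X) + _](bigD1 j)//=.
have -> : \sum_(l < k | l != j) q ^+ 2 * (1 - rho * (j == l)%:R) *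
    (Z w i j * Z w i l) * beta l 0 =
    q ^+ 2 * (Z w i j * \sum_(l < k | l != j) Z w i l * beta l 0).
  rewrite !mulr_sumr; apply: eq_bigr => l lj.
  by rewrite eq_sym (negbTE lj) mulr0; ring.
ring.
Qed.

Lemma measurable_row_residual beta j i :
  measurable_fun [set: rowT i] (row_residual beta j i).
Proof.
have mZ l := @measurable_row_Z i l.
apply: measurable_funB.
  apply: measurable_funD; apply: measurable_funM => //; apply: measurable_funM => //.
    apply: measurable_sum => l; apply: measurable_funM => //.
    exact: measurable_row_X.
  exact: measurable_row_e.
apply: measurable_sum => l; apply: measurable_funM => //; apply: measurable_funM => //.
exact: measurable_funM.
Qed.

(** The mean of [gamma_hat] and that of [Sigma_hat *m beta] are both
    [Sigma *m beta]. *)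
Lemma has_mean_row_residual beta j i : has_mean P (row_residual beta j i) 0.
Proof.
have r0 : 1 - rho != 0 by rewrite subr_eq0 eq_sym lt_eqF.
pose m := \sum_l beta l 0 * (n%:R^-1 * Sigma j l).
have h1 : has_mean P (fun w => q * (Z w i j * (\sum_l X w i l * beta l 0))) m.
  have := has_mean_sum (index_enum _)
    (fun l => has_meanZ (q * beta l 0) (has_mean_ZX i j l)).
  congr (has_mean P _ _).
    apply/funext => w; rewrite !mulr_sumr; apply: eq_bigr => l _; ring.
  by apply: eq_bigr => l _; rewrite /q; field; rewrite r0 gt_eqF.
have h2 := has_meanZ q (has_mean_Ze i j).
have h3 := has_mean_sum (index_enum _)
    (fun l => has_meanZ (beta l 0) (has_mean_ZZ i j l)).
have := has_meanD (has_meanD h1 h2) (has_meanZ (-1) h3).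
congr (has_mean P _ _); last by rewrite /m; ring.
apply/funext => w; rewrite /row_residual mulN1r; congr (_ - _).
by apply: eq_bigr => l _; rewrite mulrC.
Qed.

Lemma psi1_row_residual beta j i b s : 0 < b -> sqnorm beta <= b ^+ 2 ->
  0 < s -> sigma_e <= s ->
  psi1 P (row_residual beta j i) (psi2_const R * (3 * (q ^+ 2 * b) + q * s) / n%:R).
Proof.
move=> b0 beta_b s0 se; rewrite (funext (row_residualE beta j i)).
have bq : q * b <= q ^+ 2 * b by rewrite ler_wpM2r ?(ltW b0)// expr2 ler_peMl ?(ltW q0).
have -> : psi2_const R * (3 * (q ^+ 2 * b) + q * s) / n%:R =
  (q ^+ 2 * b * (psi2_const R * (rn * rn)) + q * s * (psi2_const R * (rn * rn))) +
  (q ^+ 2 * b * (psi2_const R * (rn * rn)) + q ^+ 2 * b * (psi2_const R * (rn * rn))).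
  by rewrite rn2; ring.
have t1 : 0 < q ^+ 2 * b * (psi2_const R * (rn * rn)) by rewrite !mulr_gt0 ?exprn_gt0.
have t2 : 0 < q * s * (psi2_const R * (rn * rn)) by rewrite !mulr_gt0.
have brn : 0 < b * rn by rewrite mulr_gt0.
have srn : 0 < s * rn by rewrite mulr_gt0.
have pZ := psi2_Z_entry i j.
have abrn : 0 < psi2_const R * (rn * (b * rn)) by rewrite !mulr_gt0.
have bj : `|beta j 0| <= b.
  rewrite -(@ler_pXn2r _ 2)// ?nnegrE ?(ltW b0)// real_normK ?num_real//.
  apply: le_trans beta_b; rewrite /sqnorm (bigD1 j)//= lerDl sumr_ge0// => l _.
  exact: sqr_ge0.
apply: psi1D; rewrite ?addr_gt0//; apply: psi1D => //.
- apply: (psi1Z (psi1_mul pZ (psi2_X i b0 beta_b) rn0 brn)) => //.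
  rewrite ger0_norm ?(ltW q0)// (_ : q * _ = q * b * (psi2_const R * (rn * rn))); last by ring.
  by rewrite ler_wpM2r ?(ltW an0).
- apply: (psi1Z (psi1_mul pZ (psi2_e i s0 se) rn0 srn)); rewrite ?mulr_gt0//.
  rewrite ger0_norm ?(ltW q0)// le_eqVlt; apply/orP; left; apply/eqP; ring.
- apply: (psi1Z (psi1_mul pZ (psi2_Z i b0 beta_b) rn0 brn)) => //.
  rewrite normrN ger0_norm ?exprn_ge0 ?(ltW q0)// le_eqVlt; apply/orP; left; apply/eqP; ring.
- apply: (psi1Z (psi1_mul pZ pZ rn0 rn0)) => //.
  rewrite ler_wpM2r ?(ltW an0)// -mulrA normrM (ger0_norm (sqr_ge0 q)).
  rewrite ler_wpM2l ?sqr_ge0// normrM (ger0_norm rho0).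
  by rewrite -[leRHS]mul1r ler_pM// ltW.
Qed.

Lemma residual_concentration beta j b s t : 0 < b -> sqnorm beta <= b ^+ 2 ->
  0 < s -> sigma_e <= s -> 0 <= t <= 32 ->
  (P [set w | (t * (psi2_const R * (3 * (q ^+ 2 * b) + q * s)) <=
    `|(gamma_hat rho (Z w) (X w *m beta + e w) - Sigma_hat rho (Z w) *m beta) j 0|)%R] <=
   (2 * expR (- (n%:R * t ^+ 2 / 128)))%:E)%E.
Proof.
move=> b0 beta_b s0 se t32.
have th0 : 0 < psi2_const R * (3 * (q ^+ 2 * b) + q * s).
  by rewrite mulr_gt0// addr_gt0// !mulr_gt0 ?exprn_gt0.
have := bernstein rows_ind n0 th0 t32 (measurable_row_residual beta j)
  (fun i => psi1_row_residual j i b0 beta_b s0 se) (has_mean_row_residual beta j).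
congr (P _ <= _)%E; apply/seteqP; split => w /=;
  by rewrite residualE sumr_const mul0rn subr0.
Qed.


(** A diagonal entry of [Sigma] is [n] times the second moment of an entry of
    [X], and [x^2 <= c exp (x^2 / c)] bounds it by the exponential square
    moment. *)
Lemma lambda_min_le : lambda_min Sigma <= 2 * psi2_const R.
Proof.
pose j := Ordinal k0; pose i := Ordinal n0.
have := lambda_min_qform (delta_mx j 0) Sigma_sym; rewrite sqnorm_delta mulr1 => h.
apply: (le_trans h).
have -> : qform Sigma (delta_mx j 0) = Sigma j j.
  rewrite qformE (bigD1 j)//= (bigD1 j)//= !mxE !eqxx mul1r mulr1 !big1 ?addr0//.
    move=> l lj; rewrite big1// => l' _.
    by rewrite !mxE (negbTE lj) !mul0r.
  by move=> l lj; rewrite !mxE (negbTE lj) mulr0.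
have [_ Eexp] := psi2_X_entry i j.
have [_ EXX] := has_mean_XX i j j.
have mXij := mX i j.
suff : n%:R^-1 * Sigma j j <= psi2_const R * rn ^+ 2 * 2.
  rewrite expr2 rn2 mulrC ler_pdivrMr//.
  have -> : psi2_const R / n%:R * 2 * n%:R = 2 * psi2_const R by field; rewrite gt_eqF.
  by [].
have arn : 0 < psi2_const R * rn ^+ 2 by rewrite mulr_gt0 ?exprn_gt0.
have mexp : measurable_fun setT (fun w => expR (X w i j ^+ 2 / (psi2_const R * rn ^+ 2))).
  by apply: measurable_expR_comp; apply: measurable_funM => //; exact: measurable_funX.
rewrite -lee_fin -EXX EFinM.
apply: (@le_trans _ _ ((psi2_const R * rn ^+ 2)%:E *
    'E_P[fun w => expR (X w i j ^+ 2 / (psi2_const R * rn ^+ 2))])%E); last first.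
  by rewrite lee_wpmul2l// lee_fin ltW.
rewrite -ge0_expectationZl ?(ltW arn)//.
apply: ge0_le_expectation.
- exact: measurable_funM.
- exact: measurable_funM.
move=> w; rewrite -expr2 sqr_ge0/= mulrC -ler_pdivrMr//.
by apply: le_trans (expR_ge1Dx _); rewrite lerDr.
Qed.

Let random_mx_Z : random_mx Z.
Proof.
move=> i j; under eq_fun do rewrite eraseE; apply: measurable_funM; last exact: mX.
by apply: measurable_keep; exact: mD.
Qed.

Let random_mx_Sigma_hat : random_mx (fun w => Sigma_hat rho (Z w)).
Proof.
move=> i j; under eq_fun do rewrite mxE; apply: measurable_funM => //.
under eq_fun do rewrite mxE; apply: measurable_sum => l.
by under eq_fun do rewrite mxE; apply: measurable_funM; exact: random_mx_Z.
Qed.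

Lemma Sigma_hat_sym w : (Sigma_hat rho (Z w))^T = Sigma_hat rho (Z w).
Proof.
apply/matrixP => j l; rewrite mxE /Sigma_hat /hadamard 2!mxE.
rewrite [in RHS]mxE !correction_mxE [j == l]eq_sym; congr (_ * _).
by rewrite !mxE; apply: eq_bigr => i _; rewrite mulrC !mxE.
Qed.

(** Outside the union of the bad events of [qform_concentration] over the grid
    and of [residual_concentration] over the coordinates, the deterministic
    lemmas [qform_le_grid] and [l2norm_solve_le] apply. *)
Lemma estimation_error (beta : 'cV[R]_k) (p : nat) :
  (k <= p)%N -> (1 < p)%N -> 0 <= sigma_e -> 0 < lambda_min Sigma ->
  256 * 256 * psi2_const R ^+ 2 * ((1 - rho) ^+ 4 * lambda_min Sigma ^+ 2)^-1
    * (k%:R * ln p%:R) <= n%:R ->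
  ((1 - 4 * p%:R^-1)%:E <=
   P [set w | (pos_def (Sigma_hat rho (Z w)) /\
       l2norm (beta_hat rho (Z w) (X w *m beta + e w) - beta) <=
         96 * psi2_const R * (((1 - rho) ^+ 2)^-1 * l2norm beta + (1 - rho)^-1 * sigma_e)
           * (lambda_min Sigma)^-1 * Num.sqrt (k%:R * ln p%:R / n%:R))%R])%E.
Proof.
move=> kp p1 se0 lam0 nlarge.
set lam := lambda_min Sigma in lam0 nlarge *; set a := psi2_const R in nlarge *.
set L := ln p%:R in nlarge *; set N := l2norm beta.
have lam_a : lam <= 2 * a := lambda_min_le.
have p0 : 0 < p%:R :> R by rewrite ltr0n (ltn_trans _ p1).
have L0 : 0 < L by rewrite ln_gt0// ltr1n.
have a20 : 0 < a ^+ 2 by rewrite exprn_gt0.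
have q20 : 0 < q ^+ 2 by rewrite exprn_gt0.
have q21 : 1 <= q ^+ 2 by rewrite exprn_ege1.
have N0 : 0 <= N by exact: sqrtr_ge0.
have {}nlarge : 256 * 256 * a ^+ 2 * (q ^+ 2) ^+ 2 * (k%:R * L) <= n%:R * lam ^+ 2.
  rewrite -ler_pdivrMr ?exprn_gt0//; apply: le_trans nlarge.
  rewrite le_eqVlt; apply/orP; left; apply/eqP; rewrite /q; field.
  by rewrite subr_eq0 gt_eqF// gt_eqF.
pose tA := form_level a q lam.
have tA32 := form_level_range a0 q1 lam0 lam_a.
have tAE : tA * (2 * a * q ^+ 2) = lam / 4 := form_levelE lam a0 q1.
have probA := form_level_tail p1 a0 q1 nlarge; rewrite -/tA in probA.
pose tB := residual_level R n p.
have tB32 := residual_level_range n0 k0 p1 a0 q1 lam0 lam_a nlarge.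
have tB0 : 0 <= tB by case/andP: tB32.
have probB := residual_level_tail R n0 p1; rewrite -/tB in probB.
pose r w := gamma_hat rho (Z w) (X w *m beta + e w) - Sigma_hat rho (Z w) *m beta.
have mr j : measurable_fun setT (fun w => `|r w j 0|).
  apply: measurableT_comp => //; rewrite (funext (residualE beta j)).
  apply: measurable_sum => i; have [Gm _ _ _] := rows_ind.
  exact: (measurable_fun_sub_sigma (Gm i)) (@measurable_row_residual beta j i).
pose tau := tB * (a * (3 * (q ^+ 2 * N) + q * sigma_e)).
pose BA (g : {ffun 'I_k -> 'I_(4 * k ^ 2).*2.+1}) : set T :=
  if sqnorm (gridvec g : 'cV[R]_k) <= 1 then
    [set w | (tA * (2 * a * q ^+ 2) <= `|qform (Sigma_hat rho (Z w) - Sigma) (gridvec g)|)%R]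
  else set0.
pose BB (j : 'I_k) : set T := [set w | tau < `|r w j 0|].
have mBA g : measurable (BA g).
  rewrite /BA; case: ifP => // _; rewrite -[X in measurable X]setTI.
  apply: (measurable_fun_le (f := cst _)) => //.
  apply: measurableT_comp => //; apply: measurable_qform => j l.
  under eq_fun do rewrite mxE [(- Sigma) _ _]mxE.
  by apply: measurable_funB => //; exact: random_mx_Sigma_hat.
have mBB j : measurable (BB j).
  rewrite (_ : BB j = ~` [set w | `|r w j 0| <= tau]).
    apply: measurableC; rewrite -[X in measurable X]setTI.
    exact: (measurable_fun_le (g := cst _)).
  by apply/seteqP; split => w /=; rewrite /BB /= ltNge => /negP.
have PA g : (P (BA g) <= (2 * (p%:R ^+ (8 * k))^-1)%:E)%E.
  rewrite /BA; case: ifP => [g1|_]; last first.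
    by rewrite measure0 lee_fin mulr_ge0 ?invr_ge0 ?exprn_ge0// ltW.
  by apply: (le_trans (qform_concentration g1 tA32)); rewrite lee_fin.
have PB j : (P (BB j) <= (2 * (p%:R ^+ 2)^-1)%:E)%E.
  apply: strict_tail_le; first exact: mr.
  move=> eps eps0.
  pose C := tB * (a * (3 * q ^+ 2 + q)).
  have C0 : 0 <= C by rewrite !mulr_ge0 ?addr_ge0 ?mulr_ge0 ?(ltW q20) ?(ltW q0) ?(ltW a0).
  have C1 : 0 < C + 1 by rewrite ltr_pwDr.
  (* [C] may vanish, whence the denominator [C + 1] *)
  pose eta := eps / (C + 1).
  have eta0 : 0 < eta by rewrite divr_gt0.
  have Ceta : C * eta <= eps.
    by rewrite /eta mulrCA ler_piMr ?(ltW eps0)// ler_pdivrMr// mul1r lerDl.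
  have bN : sqnorm beta <= (N + eta) ^+ 2.
    have -> : sqnorm beta = N ^+ 2 by rewrite /N l2normE sqr_sqrtr ?sqnorm_ge0.
    by rewrite ler_pXn2r ?nnegrE ?addr_ge0 ?(ltW eta0)// lerDl ltW.
  have conc := @residual_concentration beta j (N + eta) (sigma_e + eta) tB
    (ltr_wpDl N0 eta0) bN (ltr_wpDl se0 eta0) _ tB32.
  apply: (@le_trans _ _ (2 * expR (- (n%:R * tB ^+ 2 / 128)))%:E); last by rewrite lee_fin.
  apply: le_trans (conc _); last by rewrite lerDl ltW.
  have mle (c : R) : measurable [set w | c <= `|r w j 0|].
    by rewrite -[X in measurable X]setTI; exact: (measurable_fun_le (f := cst _)).
  apply: le_measure; [exact: mem_set (mle _)|exact: mem_set (mle _)|].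
  move=> w /=; apply: le_trans; apply: le_trans (lerD (lexx tau) Ceta).
  rewrite le_eqVlt; apply/orP; left; apply/eqP; rewrite /tau /C -/a; ring.
have [mUA PUA] := finite_union_bound mBA PA.
have [mUB PUB] := finite_union_bound mBB PB.
have cardA := grid_union_bound R k0 p1 kp.
have cardB := coordinates_union_bound R p1 kp.
set good := [set w | _].
have mgood : measurable good.
  have rhs0 : 0 <= 96 * a * (((1 - rho) ^+ 2)^-1 * N + (1 - rho)^-1 * sigma_e)
           * lam^-1 * Num.sqrt (k%:R * L / n%:R).
    rewrite mulr_ge0 ?sqrtr_ge0// mulr_ge0 ?invr_ge0 ?(ltW lam0)// mulr_ge0//.
      by rewrite mulr_ge0// ltW.
    by rewrite addr_ge0 ?mulr_ge0 ?invr_ge0 ?sqr_ge0// subr_ge0 ltW.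
  apply: (measurable_solve_close _ random_mx_Sigma_hat _ Sigma_hat_sym rhs0).
  move=> j l; under eq_fun do rewrite mxE.
  apply: measurable_funM => //; apply: random_mxM => [i i'|i i'].
    by under eq_fun do rewrite mxE; exact: random_mx_Z.
  under eq_fun do rewrite mxE; apply: measurable_funD; last exact: me.
  by apply: random_mxM.
pose bad := [set w | exists g, BA g w] `|` [set w | exists j, BB j w].
have mbad : measurable bad by exact: measurableU.
have Pbad : (P bad <= (4 * p%:R^-1)%:E)%E.
  apply: (le_trans (measureU2 _ mUA mUB)).
  rewrite (_ : 4 * _ = 2 * p%:R^-1 + 2 * p%:R^-1); last by ring.
  by rewrite EFinD leeD// ?(le_trans PUA) ?(le_trans PUB)// lee_fin.
have sub : ~` bad `<=` good.
  move=> w /= wbad.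
  have nA (g : {ffun 'I_k -> 'I_(4 * k ^ 2).*2.+1}) : sqnorm (gridvec g : 'cV[R]_k) <= 1 ->
      `|qform (Sigma_hat rho (Z w) - Sigma) (gridvec g)| <= lam / 4.
    move=> g1; rewrite leNgt; apply/negP => h; apply: wbad; left; exists g.
    by rewrite /BA g1 /= tAE ltW.
  have nB j : `|r w j 0| <= tau.
    by rewrite leNgt; apply/negP => h; apply: wbad; right; exists j.
  have dsym : (Sigma_hat rho (Z w) - Sigma)^T = Sigma_hat rho (Z w) - Sigma.
    by rewrite linearB/= Sigma_hat_sym Sigma_sym.
  have dev := qform_le_grid dsym k0 nA.
  have lower u : lam / 2 * sqnorm u <= qform (Sigma_hat rho (Z w)) u.
    have h1 := lambda_min_qform u Sigma_sym.
    have := dev u; rewrite qformB ler_norml => /andP[h2 _].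
    exact: half_le_of_dist_le h1 h2.
  have pd : pos_def (Sigma_hat rho (Z w)).
    split; first exact: Sigma_hat_sym.
    move=> u u0; rewrite -/(qform _ u); apply: lt_le_trans (lower u).
    by rewrite mulr_gt0 ?sqnorm_gt0// divr_gt0.
  split=> //.
  have Su := pos_def_unit pd.
  have -> : beta_hat rho (Z w) (X w *m beta + e w) - beta =
      invmx (Sigma_hat rho (Z w)) *m r w.
    by rewrite /beta_hat /r mulmxBr mulKmx.
  have tau0 : 0 <= tau.
    by rewrite !mulr_ge0 ?addr_ge0 ?mulr_ge0 ?(ltW q20) ?(ltW q0) ?(ltW a0).
  have lam2 : 0 < lam / 2 by rewrite divr_gt0.
  apply: (le_trans (l2norm_solve_le pd lam2 lower tau0 nB)).
  have -> : Num.sqrt (k%:R * L / n%:R) = Num.sqrt k%:R * Num.sqrt (L / n%:R).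
    by rewrite -mulrA sqrtrM.
  rewrite /tau /tB /residual_level -/q -exprVn -/q; set s := Num.sqrt (L / n%:R); set sk := Num.sqrt k%:R.
  have -> : (lam / 2)^-1 * (sk * (16 * s * (a * (3 * (q ^+ 2 * N) + q * sigma_e)))) =
    32 * a * (3 * (q ^+ 2 * N) + q * sigma_e) * lam^-1 * (sk * s).
    by field; rewrite gt_eqF.
  rewrite ler_wpM2r ?mulr_ge0 ?sqrtr_ge0// ler_wpM2r ?invr_ge0 ?(ltW lam0)//.
  rewrite -subr_ge0 (_ : _ - _ = 64 * a * (q * sigma_e)); last by ring.
  by rewrite !mulr_ge0 ?(ltW a0) ?(ltW q0).
apply: (@le_trans _ _ (P (~` bad))); last first.
  by apply: le_measure => //; rewrite inE//; exact: measurableC.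
rewrite probability_setC//.
have Pfin : P bad \is a fin_num by exact: fin_num_measure.
rewrite -(fineK Pfin) -EFinB lee_fin lerD2l lerN2 -lee_fin fineK//.
Qed.

End Model.

Theorem corollary16 (R : realType) :
  exists c C C1 C2 : R, [/\ 0 < c, 0 < C, 0 < C1 & 0 < C2] /\
  forall (d : measure_display) (T : measurableType d) (P : probability T R)
    (n k p : nat) (Sigma_x : 'M[R]_k) (sigma sigma_e rho : R)
    (X : T -> 'M[R]_(n, k)) (e : T -> 'cV[R]_n) (beta : 'cV[R]_k)
    (D : T -> 'M[bool]_(n, k)),
  (0 < n)%N -> (0 < k)%N -> (k <= p)%N ->
  0 <= sigma_e -> 0 <= rho -> rho < 1 ->
  subgaussian_mx P X Sigma_x 1 ->
  subgaussian_mx P e (sigma ^+ 2)%:M sigma_e ->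
  independent P (sigma_mx X) (sigma_mx e) ->
  0 < lambda_min Sigma_x ->
  erasure_mask P rho D ->
  independent P (sigma_mx D) (sigma_mx (fun w => row_mx (X w) (e w))) ->
  n%:R >= c * ((1 - rho) ^+ 4 * lambda_min Sigma_x ^+ 2)^-1
          * (k%:R * ln p%:R) ->
  let y : T -> 'cV[R]_n := fun w => X w *m beta + e w in
  let Z : T -> 'M[R]_(n, k) := fun w => erase (D w) (X w) in
  ((1 - C1 * (p%:R `^ (- C2)))%R%:E <=
   P [set w | (pos_def (Sigma_hat rho (Z w)) /\
       l2norm (beta_hat rho (Z w) (y w) - beta) <=
         C * (((1 - rho) ^+ 2)^-1 * l2norm beta + (1 - rho)^-1 * sigma_e)
           * (lambda_min Sigma_x)^-1 * Num.sqrt (k%:R * ln p%:R / n%:R))%R])%E.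
Proof.
have a0 := psi2_const_gt0 R.
exists (256 * 256 * psi2_const R ^+ 2), (96 * psi2_const R), 4, 1; split.
  by split; rewrite // !mulr_gt0 ?exprn_gt0.
move=> d T P n k p Sigma_x sigma sigma_e rho X e beta D n0 k0 kp se0 r0 r1 HX He XE
  lam0 HD DXE nlarge /=.
have p0 : (0 < p)%N by exact: leq_trans kp.
rewrite powR_inv1//.
have [p1|] := ltnP 1 p; first exact: (estimation_error n0 k0 r0 r1 HX He XE HD DXE).
(* for [p = 1] the lower bound is negative *)
move=> p_le1; have -> : p = 1%N by apply/eqP; rewrite eqn_leq p_le1.
rewrite invr1 mulr1; apply: (@le_trans _ _ 0%E); last exact: measure_ge0.
by rewrite lee_fin; lra.
Qed.
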